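(* Let $n\ge 1$ and let $\sigma:P_n(\mathbb{C})\to P_n(\mathbb{C})$ be an origin-preserving polynomial symplectomorphism over the complex numbers (all images of the generators $x_i,p_i$ have zero constant term). Then there exists a sequence $\psi_1,\psi_2,\ldots,\psi_k,\ldots$ of tame automorphisms of the $n$-th Weyl algebra $W_n(\mathbb{C})$ such that their images $\sigma_k$ in $\mathrm{Aut}\,P_n(\mathbb{C})$, under the canonical isomorphism $\mathrm{TAut}\,W_n(\mathbb{C})\to \mathrm{TAut}\,P_n(\mathbb{C})$, converge to $\sigma$ in the formal power series topology.
   Context: $P_n(\mathbb{C})$ is the polynomial algebra $\mathbb{C}[x_1,\ldots,x_n,p_1,\ldots,p_n]$ with the standard Poisson bracket: the biderivation with $\{p_i,x_j\}=\delta_{ij}$, $\{x_i,x_j\}=\{p_i,p_j\}=0$. A polynomial symplectomorphism is a $\mathbb{C}$-algebra automorphism preserving this bracket; $\mathrm{Aut}\,P_n(\mathbb{C})$ is the group of these. The Weyl algebra $W_n(\mathbb{C})$ is the associative unital $\mathbb{C}$-algebra generated by $\hat x_1,\ldots,\hat x_n,\hat p_1,\ldots,\hat p_n$ with relations $\hat p_i\hat x_j-\hat x_j\hat p_i=\delta_{ij}$, $[\hat x_i,\hat x_j]=[\hat p_i,\hat p_j]=0$. Endomorphisms are identified with the tuples of images of the generators. Tame automorphisms: $\mathrm{TAut}\,P_n(\mathbb{C})$ is the subgroup of $\mathrm{Aut}\,P_n(\mathbb{C})$ generated by the symplectomorphisms of the following forms: (i) linear symplectic changes of variables $(x_1,\ldots,x_n,p_1,\ldots,p_n)\mapsto(x_1,\ldots,x_n,p_1,\ldots,p_n)A$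 with $A\in \mathrm{Sp}(2n,\mathbb{C})$; (ii) elementary transformations $(x_1,\ldots,x_{k-1},x_k+f(p_1,\ldots,p_n),x_{k+1},\ldots,x_n,p_1,\ldots,p_n)$ that preserve the bracket; (iii) elementary transformations $(x_1,\ldots,x_n,p_1,\ldots,p_{k-1},p_k+g(x_1,\ldots,x_n),p_{k+1},\ldots,p_n)$ that preserve the bracket. Here $f,g$ are polynomials with zero constant term. The group $\mathrm{TAut}\,W_n(\mathbb{C})$ of tame automorphisms of $W_n(\mathbb{C})$ is the subgroup of $\mathrm{Aut}\,W_n(\mathbb{C})$ generated by the automorphisms of exactly the same forms (i)–(iii), with $x_i,p_i$ replaced by $\hat x_i,\hat p_i$. Known theorem of Kanel-Belov and Kontsevich: there is a group isomorphism $\mathrm{TAut}\,W_n(\mathbb{C})\to\mathrm{TAut}\,P_n(\mathbb{C})$; it sends each linear or elementary generator to the generator given by the same formula, with $\hat x_i,\hat p_i$ replaced by $x_i,p_i$. The image $\sigma_k$ of $\psi_k$ is taken under this isomorphism. Height: the height $\mathrm{ht}(f)$ of a polynomial $f$ is the least $k$ such that its homogeneous component of total degree $k$ is nonzero (all generators have degree 1), $\mathrm{ht}(0)=\infty$; for a tuple it is the minimum of the heights of the entries. The formal power series topology on endomorphisms of the polynomial algebra is given by the metric $d(\varphi,\psi)=\exp(-\mathrm{ht}(\varphi-\psi))$, with $\varphi-\psi$ the tuple of entrywise differences. *)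

(* Defs.v *)
From HB Require Import structures.
From mathcomp Require Import all_boot all_order all_algebra.
From mathcomp Require Import boolp classical_sets functions reals constructive_ereal.
From mathcomp Require Import ereal topology normedtype sequences exp complex.
From mathcomp Require Import ring.
(* The notations of the multinomials library clash with those of
   mathcomp-analysis, hence the filtered imports. *)
From mathcomp Require Import -(notations) monalg.
From mathcomp Require Import -(notations) mpoly.

Set Implicit Arguments.
Unset Strict Implicit.
Unset Printing Implicit Defensive.

Import Order.TTheory GRing.Theory Num.Theory.
Import numFieldNormedType.Exports.

Local Open Scope classical_set_scope.
Local Open Scope ring_scope.

(* The 2n generators are indexed by 'I_(n + n): first the positions, then the
   momenta. *)
Definition xvar n (i : 'I_n) : 'I_(n + n) := lshift n i.
Definition pvar n (i : 'I_n) : 'I_(n + n) := rshift n i.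

Inductive ideal_gen (A : nzRingType) (S : set A) : A -> Prop :=
| IdealGen a of S a : ideal_gen S a
| Ideal0 : ideal_gen S 0
| IdealD a b of ideal_gen S a & ideal_gen S b : ideal_gen S (a + b)
| IdealMl a b of ideal_gen S b : ideal_gen S (a * b)
| IdealMr a b of ideal_gen S a : ideal_gen S (a * b).

Section IdealTheory.
Variables (A : nzRingType) (S : set A).
Implicit Types a b c d : A.

Lemma ideal_genN a : ideal_gen S a -> ideal_gen S (- a).
Proof. by move=> Sa; rewrite -mulN1r; apply: IdealMl. Qed.

Lemma ideal_genB a b : ideal_gen S a -> ideal_gen S b -> ideal_gen S (a - b).
Proof. by move=> Sa Sb; apply: IdealD => //; apply: ideal_genN. Qed.

Lemma ideal_genM a b c d :
  ideal_gen S (a - b) -> ideal_gen S (c - d) -> ideal_gen S (a * c - b * d).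
Proof.
move=> Sab Scd; have -> : a * c - b * d = (a - b) * c + b * (c - d).
  by rewrite mulrBl mulrBr addrA subrK.
by apply: IdealD; [exact: IdealMr | exact: IdealMl].
Qed.

End IdealTheory.

Section FreeAlgebra.
Variables (K : comNzRingType) (I : choiceType).

Definition free_alg := malg (fmonom I) K.
HB.instance Definition _ := GRing.Lalgebra.on free_alg.

Definition free_gen (i : I) : free_alg := mkmalgU (fmu i) 1.

Lemma free_algUM (c d : K) (k l : fmonom I) :
  (mkmalgU k c : free_alg) * mkmalgU l d = mkmalgU (mmul k l) (c * d).
Proof. exact: fgmulUU. Qed.

Lemma free_scaleAr (c : K) (a b : free_alg) : c *: (a * b) = a * (c *: b).
Proof.
suff comm : mkmalgU mone c * a = a * mkmalgU mone c.
  by rewrite -[c *: b]mul_malgC mulrA -comm -mulrA mul_malgC.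
rewrite [a]monalgE mulr_sumr mulr_suml; apply: eq_bigr => k _.
by rewrite !free_algUM mul1m mulm1 mulrC.
Qed.

HB.instance Definition _ := GRing.Lalgebra_isAlgebra.Build K free_alg free_scaleAr.

End FreeAlgebra.

Section WeylAlgebra.
Variables (K : comNzRingType) (n : nat).

Local Notation F := (free_alg K 'I_(n + n)).
Local Notation x i := (@free_gen K 'I_(n + n) (xvar i)).
Local Notation p i := (@free_gen K 'I_(n + n) (pvar i)).

Definition weyl_relators : set F :=
  [set r | exists i j : 'I_n,
    [\/ r = p i * x j - x j * p i - (i == j)%:R,
        r = x i * x j - x j * x i
      | r = p i * p j - p j * p i]].

Definition weyl_eqv (a b : F) : bool := `[< ideal_gen weyl_relators (a - b) >].

Lemma weyl_eqv_refl : reflexive weyl_eqv.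
Proof. by move=> a; apply/asboolP; rewrite subrr; apply: Ideal0. Qed.

Lemma weyl_eqv_sym : ssrbool.symmetric weyl_eqv.
Proof.
by move=> a b; apply/asboolP/asboolP => /ideal_genN; rewrite opprB.
Qed.

Lemma weyl_eqv_trans : transitive weyl_eqv.
Proof.
move=> b a c /asboolP ab /asboolP bc; apply/asboolP.
by rewrite -[a](subrK b) -addrA; apply: IdealD.
Qed.

Canonical weyl_equivRel :=
  EquivRel weyl_eqv weyl_eqv_refl weyl_eqv_sym weyl_eqv_trans.

(* See [weyl_universal] for the universal property of this presentation. *)
Definition weyl := {eq_quot weyl_eqv}%qT.
HB.instance Definition _ : EqQuotient _ weyl_eqv weyl := EqQuotient.on weyl.
HB.instance Definition _ := Choice.on weyl.

Definition weyl_pi (a : F) : weyl := (\pi_weyl a)%qT.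

Lemma weyl_piP (a b : F) :
  weyl_pi a = weyl_pi b <-> ideal_gen weyl_relators (a - b).
Proof. by split=> [/eqmodP/asboolP|H]; [|apply/eqmodP/asboolP]. Qed.

Lemma weyl_reprK (u : weyl) : weyl_pi (repr u) = u.
Proof. exact: reprK. Qed.

Lemma weyl_repr_pi (a : F) : ideal_gen weyl_relators (repr (weyl_pi a) - a).
Proof. by apply/weyl_piP; rewrite weyl_reprK. Qed.

(* The locks only prevent costly conversion tests. *)
Fact weyl_key : unit. Proof. by []. Qed.

Definition weyl_add : weyl -> weyl -> weyl :=
  locked_with weyl_key (fun u v => weyl_pi (repr u + repr v)).
Definition weyl_opp : weyl -> weyl :=
  locked_with weyl_key (fun u => weyl_pi (- repr u)).
Definition weyl_mul : weyl -> weyl -> weyl :=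
  locked_with weyl_key (fun u v => weyl_pi (repr u * repr v)).
Definition weyl_scale : K -> weyl -> weyl :=
  locked_with weyl_key (fun c u => weyl_pi (c *: repr u)).

Lemma weyl_addE a b : weyl_add (weyl_pi a) (weyl_pi b) = weyl_pi (a + b).
Proof.
rewrite /weyl_add locked_withE; apply/weyl_piP; rewrite opprD addrACA.
by apply: IdealD; apply: weyl_repr_pi.
Qed.

Lemma weyl_oppE a : weyl_opp (weyl_pi a) = weyl_pi (- a).
Proof.
rewrite /weyl_opp locked_withE; apply/weyl_piP; rewrite -opprD.
exact/ideal_genN/weyl_repr_pi.
Qed.

Lemma weyl_mulE a b : weyl_mul (weyl_pi a) (weyl_pi b) = weyl_pi (a * b).
Proof.
rewrite /weyl_mul locked_withE; apply/weyl_piP; apply: ideal_genM; exact: weyl_repr_pi.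
Qed.

Lemma weyl_scaleE c a : weyl_scale c (weyl_pi a) = weyl_pi (c *: a).
Proof.
rewrite /weyl_scale locked_withE; apply/weyl_piP; rewrite -scalerBr -[_ - a]mul1r scalerAl.
exact/IdealMl/weyl_repr_pi.
Qed.

Lemma weyl_ind (P : weyl -> Prop) : (forall a, P (weyl_pi a)) -> forall u, P u.
Proof. by move=> Ppi u; rewrite -(weyl_reprK u). Qed.

Lemma weyl_addA : associative weyl_add.
Proof.
elim/weyl_ind=> a; elim/weyl_ind=> b; elim/weyl_ind=> c.
by rewrite !weyl_addE addrA.
Qed.

Lemma weyl_addC : commutative weyl_add.
Proof. by elim/weyl_ind=> a; elim/weyl_ind=> b; rewrite !weyl_addE addrC. Qed.

Lemma weyl_add0 : left_id (weyl_pi 0) weyl_add.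
Proof. by elim/weyl_ind=> a; rewrite weyl_addE add0r. Qed.

Lemma weyl_addN : left_inverse (weyl_pi 0) weyl_opp weyl_add.
Proof. by elim/weyl_ind=> a; rewrite weyl_oppE weyl_addE addNr. Qed.

HB.instance Definition _ :=
  GRing.isZmodule.Build weyl weyl_addA weyl_addC weyl_add0 weyl_addN.

Lemma weyl_piD a b : weyl_pi (a + b) = weyl_pi a + weyl_pi b.
Proof. by rewrite -weyl_addE. Qed.

Lemma weyl_mulA : associative weyl_mul.
Proof.
elim/weyl_ind=> a; elim/weyl_ind=> b; elim/weyl_ind=> c.
by rewrite !weyl_mulE mulrA.
Qed.

Lemma weyl_mul1l : left_id (weyl_pi 1) weyl_mul.
Proof. by elim/weyl_ind=> a; rewrite weyl_mulE mul1r. Qed.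

Lemma weyl_mul1r : right_id (weyl_pi 1) weyl_mul.
Proof. by elim/weyl_ind=> a; rewrite weyl_mulE mulr1. Qed.

Lemma weyl_mulDl : left_distributive weyl_mul +%R.
Proof.
elim/weyl_ind=> a; elim/weyl_ind=> b; elim/weyl_ind=> c.
by rewrite -weyl_piD !weyl_mulE -weyl_piD mulrDl.
Qed.

Lemma weyl_mulDr : right_distributive weyl_mul +%R.
Proof.
elim/weyl_ind=> a; elim/weyl_ind=> b; elim/weyl_ind=> c.
by rewrite -weyl_piD !weyl_mulE -weyl_piD mulrDr.
Qed.

(* The free algebra acts on K[x_1, ..., x_n], x_i by multiplication and p_i by
   d/dx_i; this shows that 1 is not in the ideal generated by the relators. *)
Definition gen_act (j : 'I_(n + n)) (q : mpoly n K) : mpoly n K :=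
  match fintype.split j with
  | inl i => mpolyX K (mnm1 i) * q
  | inr i => mderiv i q
  end.

Definition word_act (m : fmonom 'I_(n + n)) (q : mpoly n K) : mpoly n K :=
  foldr gen_act q (fmonom_val m).

Definition free_act (a : F) (q : mpoly n K) : mpoly n K :=
  monalg.mmap (@mpolyC n K) (fun m => word_act m q) a.

Lemma gen_act_linear j : linear (gen_act j).
Proof.
move=> c q r; rewrite /gen_act; case: fintype.split => i; last exact: linearP.
by rewrite mulrDr scalerAr.
Qed.

Lemma word_act_linear m : linear (word_act m).
Proof.
rewrite /word_act => c q r.
by elim: (fmonom_val m) => //= j s ->; rewrite gen_act_linear.
Qed.

Lemma free_actD a b q : free_act (a + b) q = free_act a q + free_act b q.
Proof. exact: monalg.mmapD. Qed.

Lemma free_actB a b q : free_act (a - b) q = free_act a q - free_act b q.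
Proof. exact: monalg.mmapB. Qed.

Lemma free_act0 q : free_act 0 q = 0.
Proof. exact: monalg.mmap0. Qed.

Lemma free_actU c m q : free_act (mkmalgU m c) q = c *: word_act m q.
Proof. by rewrite /free_act monalg.mmapU mul_mpolyC. Qed.

Lemma free_act_sum I (s : seq I) (f : I -> F) q :
  free_act (\sum_(i <- s) f i) q = \sum_(i <- s) free_act (f i) q.
Proof.
exact: (big_morph (free_act^~ q) (fun a b => free_actD a b q) (free_act0 q)).
Qed.

Lemma free_act1 q : free_act 1 q = q.
Proof. by rewrite free_actU scale1r /word_act fm1. Qed.

Lemma free_act_linear a : linear (free_act a).
Proof.
move=> c q r; rewrite [a]monalgE !free_act_sum scaler_sumr -big_split /=.
apply: eq_bigr => m _; rewrite !free_actU word_act_linear scalerDr.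
by rewrite !scalerA mulrC.
Qed.

Lemma free_actM a b q : free_act (a * b) q = free_act a (free_act b q).
Proof.
have lin0 (f : mpoly n K -> mpoly n K) : linear f -> f 0 = 0.
  by move=> lf; have := lf (-1) 0 0; rewrite !scaleN1r !addNr.
rewrite [b]monalgE mulr_sumr !free_act_sum.
rewrite (big_morph (free_act a) (id1 := 0) (op1 := +%R)); first last.
- exact/lin0/free_act_linear.
- by move=> u v; rewrite -[u]scale1r free_act_linear !scale1r.
apply: eq_bigr => l _.
rewrite [a]monalgE mulr_suml !free_act_sum; apply: eq_bigr => k _.
rewrite free_algUM !free_actU -scalerA; congr (_ *: _).
rewrite -[_ *: word_act l q]addr0 word_act_linear (lin0 _ (word_act_linear k)).
rewrite addr0; congr (_ *: _).
by rewrite /word_act /= [mmul _ _]fmmulE /= foldr_cat.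
Qed.

Lemma free_act_gen j q : free_act (free_gen K j) q = gen_act j q.
Proof. by rewrite free_actU scale1r /word_act fmuE. Qed.

Lemma free_act_nat k q : free_act k%:R q = k%:R * q.
Proof.
elim: k => [|k IH]; first by rewrite free_act0 mul0r.
by rewrite -addn1 !natrD free_actD IH free_act1 mulrDl mul1r.
Qed.

Lemma gen_act_x i q : gen_act (xvar i) q = mpolyX K (mnm1 i) * q.
Proof. by rewrite /gen_act /xvar (unsplitK (inl i : 'I_n + 'I_n)). Qed.

Lemma gen_act_p i q : gen_act (pvar i) q = mderiv i q.
Proof. by rewrite /gen_act /pvar (unsplitK (inr i : 'I_n + 'I_n)). Qed.

Lemma free_act_commutator u v q :
  free_act (u * v - v * u) q = free_act u (free_act v q) - free_act v (free_act u q).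
Proof.
rewrite free_actB.
exact: (congr2 (fun a b => a - b) (free_actM u v q) (free_actM v u q)).
Qed.

Lemma free_act_relators a :
  ideal_gen weyl_relators a -> forall q, free_act a q = 0.
Proof.
elim=> {a} [a [i [j Ha]]||a b _ IHa _ IHb|a b _ IH|a b _ IH] q.
- case: Ha => ->.
  + rewrite free_actB free_act_nat free_act_commutator !free_act_gen.
    rewrite !gen_act_x !gen_act_p mderivM mderivX addrK mnm1E.
    rewrite eq_sym; case: eqP => [->|_]; last by rewrite scale0r mul0r subrr.
    have -> : mnm_sub (mnm1 j) (mnm1 j) = mnm0.
      by apply/mnmP => k; rewrite mnmBE subnn mnm0E.
    by rewrite scale1r mpolyX0 subrr.
  + by rewrite free_act_commutator !free_act_gen !gen_act_x mulrCA subrr.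
  + by rewrite free_act_commutator !free_act_gen !gen_act_p mderiv_comm subrr.
- exact: free_act0.
- by rewrite free_actD IHa IHb addr0.
- rewrite free_actM IH; have := free_act_linear a (-1) 0 0.
  by rewrite !scaleN1r !addNr.
- by rewrite free_actM IH.
Qed.

Lemma weyl_oner_neq0 : weyl_pi 1 != 0.
Proof.
apply/eqP => /weyl_piP; rewrite subr0 => /free_act_relators /(_ 1).
by rewrite free_act1 => /eqP; rewrite oner_eq0.
Qed.

HB.instance Definition _ := GRing.Zmodule_isNzRing.Build weyl
  weyl_mulA weyl_mul1l weyl_mul1r weyl_mulDl weyl_mulDr weyl_oner_neq0.

Lemma weyl_piM a b : weyl_pi (a * b) = weyl_pi a * weyl_pi b.
Proof. by rewrite -weyl_mulE. Qed.

Lemma weyl_scaleA c d u : weyl_scale c (weyl_scale d u) = weyl_scale (c * d) u.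
Proof. by elim/weyl_ind: u => a; rewrite !weyl_scaleE scalerA. Qed.

Lemma weyl_scale1 : left_id 1 weyl_scale.
Proof. by elim/weyl_ind=> a; rewrite weyl_scaleE scale1r. Qed.

Lemma weyl_scaleDr : right_distributive weyl_scale +%R.
Proof.
move=> c; elim/weyl_ind=> a; elim/weyl_ind=> b.
by rewrite -weyl_piD !weyl_scaleE -weyl_piD scalerDr.
Qed.

Lemma weyl_scaleDl u : {morph weyl_scale^~ u : c d / c + d}.
Proof.
move=> c d; elim/weyl_ind: u => a.
by rewrite !weyl_scaleE -weyl_piD scalerDl.
Qed.

HB.instance Definition _ := GRing.Zmodule_isLmodule.Build K weyl
  weyl_scaleA weyl_scale1 weyl_scaleDr weyl_scaleDl.

Lemma weyl_piZ c a : weyl_pi (c *: a) = c *: weyl_pi a.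
Proof. by rewrite -weyl_scaleE. Qed.

Lemma weyl_scaleAl (c : K) (u v : weyl) : c *: (u * v) = c *: u * v.
Proof.
elim/weyl_ind: u => a; elim/weyl_ind: v => b.
by rewrite -weyl_piM -!weyl_piZ -weyl_piM scalerAl.
Qed.

HB.instance Definition _ := GRing.Lmodule_isLalgebra.Build K weyl weyl_scaleAl.

Lemma weyl_scaleAr (c : K) (u v : weyl) : c *: (u * v) = u * (c *: v).
Proof.
elim/weyl_ind: u => a; elim/weyl_ind: v => b.
by rewrite -weyl_piM -!weyl_piZ -weyl_piM scalerAr.
Qed.

HB.instance Definition _ := GRing.Lalgebra_isAlgebra.Build K weyl weyl_scaleAr.

Definition weyl_gen : 'I_(n + n) -> weyl :=
  locked_with weyl_key (fun j => weyl_pi (free_gen K j)).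

Lemma weyl_genE j : weyl_gen j = weyl_pi (free_gen K j).
Proof. by rewrite /weyl_gen locked_withE. Qed.

End WeylAlgebra.

(* The subgroup generated by a set S of bijections of T, under composition. *)
Inductive generated_subgroup (T : Type) (S : set (T -> T)) : set (T -> T) :=
| GenIn f of S f : generated_subgroup S f
| GenId : generated_subgroup S id
| GenComp f g of generated_subgroup S f & generated_subgroup S g :
    generated_subgroup S (f \o g)
| GenInv f g of generated_subgroup S f & cancel f g & cancel g f :
    generated_subgroup S g.

Section AlgebraAutomorphisms.
Variable K : comNzRingType.

Definition alg_hom (A B : algType K) (f : A -> B) : Prop :=
  linear f /\ GRing.monoid_morphism f.

Definition alg_aut (A : algType K) : set (A -> A) :=
  [set f | alg_hom f /\ bijective f].

End AlgebraAutomorphisms.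

Section WeylPresentation.
Variables (K : comNzRingType) (n : nat).

Definition weyl_relations (B : nzRingType) (b : 'I_(n + n) -> B) : Prop :=
  forall i j : 'I_n,
    [/\ b (pvar i) * b (xvar j) - b (xvar j) * b (pvar i) = (i == j)%:R,
        b (xvar i) * b (xvar j) - b (xvar j) * b (xvar i) = 0
      & b (pvar i) * b (pvar j) - b (pvar j) * b (pvar i) = 0].

Lemma weyl_piB a b : weyl_pi (a - b) = weyl_pi a - weyl_pi b :> weyl K n.
Proof. by rewrite weyl_piD -[X in _ + X]weyl_oppE. Qed.

Lemma weyl_pi_nat k : weyl_pi k%:R = k%:R :> weyl K n.
Proof. by elim: k => // k IH; rewrite -addn1 !natrD weyl_piD IH. Qed.

Lemma weyl_pi_commutator u v :
  weyl_pi (u * v - v * u) = weyl_pi u * weyl_pi v - weyl_pi v * weyl_pi u :> weyl K n.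
Proof.
rewrite weyl_piB.
exact: (congr2 (fun a b => a - b) (weyl_piM u v) (weyl_piM v u)).
Qed.

Lemma weyl_gen_relations : weyl_relations (@weyl_gen K n).
Proof.
move=> i j; rewrite !weyl_genE; split.
- rewrite -weyl_pi_commutator -weyl_pi_nat.
  by apply/weyl_piP/IdealGen; exists i, j; constructor 1.
- rewrite -weyl_pi_commutator.
  by apply/weyl_piP; rewrite subr0; apply: IdealGen; exists i, j; constructor 2.
- rewrite -weyl_pi_commutator.
  by apply/weyl_piP; rewrite subr0; apply: IdealGen; exists i, j; constructor 3.
Qed.

Lemma alg_hom0 (A B : algType K) (f : A -> B) : alg_hom f -> f 0 = 0.
Proof. by move=> [lf _]; have := lf (-1) 0 0; rewrite !scaleN1r !addNr. Qed.

Lemma alg_homD (A B : algType K) (f : A -> B) :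
  alg_hom f -> {morph f : a b / a + b}.
Proof. by move=> [lf _] a b; rewrite -[a]scale1r lf !scale1r. Qed.

Lemma alg_homZ (A B : algType K) (f : A -> B) c :
  alg_hom f -> {morph f : a / c *: a}.
Proof. by move=> hf a; rewrite -[c *: a]addr0 hf.1 alg_hom0 // addr0. Qed.

Definition free_lift (B : algType K) (b : 'I_(n + n) -> B)
    (a : free_alg K 'I_(n + n)) : B :=
  monalg.mmap (in_alg B) (fun m => \prod_(j <- fmonom_val m) b j) a.

Section FreeLift.
Variables (B : algType K) (b : 'I_(n + n) -> B).
Local Notation phi := (free_lift b).

Lemma free_liftD u v : phi (u + v) = phi u + phi v.
Proof. exact: monalg.mmapD. Qed.

Lemma free_lift0 : phi 0 = 0.
Proof. exact: monalg.mmap0. Qed.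

Lemma free_liftU c m : phi (mkmalgU m c) = c *: \prod_(j <- fmonom_val m) b j.
Proof. by rewrite /free_lift monalg.mmapU /= mulr_algl. Qed.

Lemma free_lift_sum I (s : seq I) (f : I -> free_alg K 'I_(n + n)) :
  phi (\sum_(i <- s) f i) = \sum_(i <- s) phi (f i).
Proof. exact: (big_morph phi free_liftD free_lift0). Qed.

Lemma free_liftM u v : phi (u * v) = phi u * phi v.
Proof.
rewrite [u]monalgE [v]monalgE mulr_suml !free_lift_sum mulr_suml.
apply: eq_bigr => k _; rewrite mulr_sumr free_lift_sum mulr_sumr.
apply: eq_bigr => l _; rewrite free_algUM !free_liftU.
by rewrite [mmul _ _]fmmulE big_cat -scalerAl -scalerAr scalerA.
Qed.

Lemma free_liftZ c u : phi (c *: u) = c *: phi u.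
Proof.
by rewrite -mul_malgC free_liftM free_liftU fm1 big_nil -scalerAl mul1r.
Qed.

Lemma free_lift1 : phi 1 = 1.
Proof. by rewrite free_liftU fm1 big_nil scale1r. Qed.

Lemma free_lift_gen j : phi (free_gen K j) = b j.
Proof. by rewrite free_liftU fmuE big_seq1 scale1r. Qed.

Lemma free_lift_nat k : phi k%:R = k%:R.
Proof.
by elim: k => [|k IH]; rewrite ?free_lift0 // -addn1 !natrD free_liftD IH free_lift1.
Qed.

Lemma free_liftB u v : phi (u - v) = phi u - phi v.
Proof. exact: monalg.mmapB. Qed.

Lemma free_lift_commutator u v :
  phi (u * v - v * u) = phi u * phi v - phi v * phi u.
Proof.
rewrite free_liftB.
exact: (congr2 (fun a b => a - b) (free_liftM u v) (free_liftM v u)).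
Qed.

Lemma free_lift_relators a :
  weyl_relations b -> ideal_gen (@weyl_relators K n) a -> phi a = 0.
Proof.
move=> rel; elim=> {a} [a [i [j Ha]]||u v _ IHu _ IHv|u v _ IH|u v _ IH].
- have [r1 r2 r3] := rel i j.
  case: Ha => ->.
  + by rewrite free_liftB free_lift_nat free_lift_commutator !free_lift_gen r1 subrr.
  + by rewrite free_lift_commutator !free_lift_gen r2.
  + by rewrite free_lift_commutator !free_lift_gen r3.
- exact: free_lift0.
- by rewrite free_liftD IHu IHv addr0.
- by rewrite free_liftM IH mulr0.
- by rewrite free_liftM IH mul0r.
Qed.

End FreeLift.

Lemma weyl_universal (B : algType K) (b : 'I_(n + n) -> B) :
  weyl_relations b ->
  exists! f : weyl K n -> B, alg_hom f /\ forall j, f (weyl_gen K j) = b j.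
Proof.
move=> rel; pose f (u : weyl K n) := free_lift b (repr u).
have fpi a : f (weyl_pi a) = free_lift b a.
  apply/eqP; rewrite -subr_eq0 -free_liftB.
  by apply/eqP/free_lift_relators => //; apply: weyl_repr_pi.
have fhom : alg_hom f.
  split.
    move=> c; elim/weyl_ind=> u; elim/weyl_ind=> v.
    by rewrite -weyl_piZ -weyl_piD !fpi free_liftD free_liftZ.
  split; first by rewrite fpi free_lift1.
  elim/weyl_ind=> u; elim/weyl_ind=> v.
  by rewrite -weyl_piM !fpi free_liftM.
exists f; split; first by split=> // j; rewrite weyl_genE fpi free_lift_gen.
move=> g [ghom gb]; apply/funext; elim/weyl_ind=> a; rewrite fpi.
pose gp (u : free_alg K 'I_(n + n)) := g (weyl_pi u).
have gpD u v : gp (u + v) = gp u + gp v by rewrite /gp weyl_piD alg_homD.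
have gp0 : gp 0 = 0 by exact: (alg_hom0 ghom).
rewrite -/(gp a) [a]monalgE free_lift_sum (big_morph gp gpD gp0).
apply: eq_bigr => m _; rewrite free_liftU.
have -> : mkmalgU m (monalg.mcoeff m a) =
  monalg.mcoeff m a *: (mkmalgU m 1 : free_alg K 'I_(n + n)).
  by rewrite -mul_malgC free_algUM mulr1 mul1m.
rewrite /gp weyl_piZ (alg_homZ _ ghom); congr (_ *: _).
case: m => s; elim: s => [|j s IH].
  rewrite big_nil; have -> : FMonom [::] = mone :> fmonom 'I_(n + n) by rewrite -fmoneE.
  exact: (esym ghom.2.1).
have -> : FMonom (j :: s) = mmul (fmu j) (FMonom s) :> fmonom 'I_(n + n).
  by rewrite [mmul _ _]fmmulE fmuE.
have -> : mkmalgU (mmul (fmu j) (FMonom s)) (1 : K) =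
    (free_gen K j : free_alg K 'I_(n + n)) * mkmalgU (FMonom s) 1.
  by rewrite free_algUM mulr1.
rewrite weyl_piM ghom.2.2 -IH -weyl_genE gb.
by rewrite [mmul _ _]fmmulE fmuE big_cons.
Qed.

End WeylPresentation.

Section Symplectic.
Variables (K : comNzRingType) (n : nat).

Local Notation P := (mpoly (n + n) K).

Definition poly_gen (j : 'I_(n + n)) : P := mpolyX K (mnm1 j).

(* [poisson_unique] below: this is the only biderivation with the standard values
   on the generators. *)
Definition poisson (f g : P) : P :=
  \sum_(i < n) (mderiv (pvar i) f * mderiv (xvar i) g
                - mderiv (xvar i) f * mderiv (pvar i) g).

Definition symplectomorphism : set (P -> P) :=
  [set s | alg_aut s /\ forall f g, s (poisson f g) = poisson (s f) (s g)].

Definition origin_preserving (s : P -> P) : Prop :=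
  forall j, mcoeff mnm0 (s (poly_gen j)) = 0.

End Symplectic.

Section PoissonTheory.
Variables (K : comNzRingType) (n : nat).

Local Notation P := (mpoly (n + n) K).
Local Notation X i := (@poly_gen K n (xvar i)).
Local Notation Y i := (@poly_gen K n (pvar i)).

Definition biderivation (b : P -> P -> P) : Prop :=
  [/\ forall g, linear (b^~ g), forall f, linear (b f),
      forall f g h, b (f * g) h = f * b g h + b f h * g
    & forall f g h, b h (f * g) = f * b h g + b h f * g].

Lemma poisson_biderivation : biderivation (@poisson K n).
Proof.
split=> [g c f h|f c g h|f g h|f g h]; rewrite /poisson.
- rewrite scaler_sumr -big_split /=; apply: eq_bigr => i _.
  rewrite !mderivD !mderivZ !mulrDl -!scalerAl scalerBr opprD.
  by rewrite addrACA.
- rewrite scaler_sumr -big_split /=; apply: eq_bigr => i _.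
  rewrite !mderivD !mderivZ !mulrDr -!scalerAr scalerBr opprD.
  by rewrite addrACA.
- rewrite mulr_sumr mulr_suml -big_split /=; apply: eq_bigr => i _.
  by rewrite !mderivM; ring.
- rewrite mulr_sumr mulr_suml -big_split /=; apply: eq_bigr => i _.
  by rewrite !mderivM; ring.
Qed.

Lemma mderiv_gen (i j : 'I_(n + n)) : mderiv i (poly_gen K j) = (i == j)%:R.
Proof.
rewrite /poly_gen mderivX mnm1E eq_sym; case: eqP => [->|_].
  have -> : mnm_sub (mnm1 j) (mnm1 j) = mnm0.
    by apply/mnmP => k; rewrite mnmBE subnn mnm0E.
  by rewrite scale1r mpolyX0.
by rewrite scale0r.
Qed.

Lemma poisson_gen (i j : 'I_n) :
  [/\ poisson (Y i) (X j) = (i == j)%:R, poisson (X i) (Y j) = - (i == j)%:R,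
      poisson (X i) (X j) = 0 & poisson (Y i) (Y j) = 0].
Proof.
have xp (k l : 'I_n) : (xvar k == pvar l) = false by rewrite eq_lrshift.
have px (k l : 'I_n) : (pvar k == xvar l) = false by rewrite eq_rlshift.
have xx (k l : 'I_n) : (xvar k == xvar l) = (k == l) by rewrite eq_lshift.
have pp (k l : 'I_n) : (pvar k == pvar l) = (k == l) by rewrite eq_rshift.
rewrite /poisson; split.
- rewrite (bigD1 i) //= big1 ?addr0 => [|k ki]; rewrite !mderiv_gen ?(xp, px, xx, pp).
    by rewrite eqxx mul1r mul0r subr0.
  by rewrite (negbTE ki) !mul0r subr0.
- rewrite (bigD1 i) //= big1 ?addr0 => [|k ki]; rewrite !mderiv_gen ?(xp, px, xx, pp).
    by rewrite eqxx mul1r mul0r sub0r.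
  by rewrite (negbTE ki) !mul0r subr0.
- by apply: big1 => k _; rewrite !mderiv_gen ?(xp, px, xx, pp) mul0r mulr0 subr0.
- by apply: big1 => k _; rewrite !mderiv_gen ?(xp, px, xx, pp) mul0r mulr0 subr0.
Qed.

Lemma derivation_eq0 (d : P -> P) : linear d ->
  (forall f g, d (f * g) = f * d g + d f * g) ->
  (forall j, d (poly_gen K j) = 0) -> forall f, d f = 0.
Proof.
move=> dlin dM dX f.
have d0 : d 0 = 0 by have := dlin (-1) 0 0; rewrite !scaleN1r !addNr.
have d1 : d 1 = 0.
  have /eqP := dM 1 1; rewrite !mul1r mulr1 -subr_eq subrr => /eqP.
  by move/esym.
have dm m : d (mpolyX K m) = 0.
  rewrite mpolyXE_id; elim/big_ind: _ => // [u v du dv|i _].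
    by rewrite dM du dv mulr0 mul0r addr0.
  elim: (m i) => [|k IH]; first by rewrite expr0.
  by rewrite exprS dM IH mulr0 add0r -/(poly_gen K i) dX mul0r.
elim/mpolyind: f => [//|c m p _ _ IH].
by rewrite dlin dm IH scaler0 addr0.
Qed.

Lemma poisson_unique (b : P -> P -> P) : biderivation b ->
  (forall i j : 'I_n, [/\ b (Y i) (X j) = (i == j)%:R,
     b (X i) (Y j) = - (i == j)%:R, b (X i) (X j) = 0 & b (Y i) (Y j) = 0]) ->
  forall f g, b f g = poisson f g.
Proof.
have [l1 r1 ml1 mr1] := poisson_biderivation.
move=> [l2 r2 ml2 mr2] bg.
have gen i j : b (poly_gen K i) (poly_gen K j) =
    poisson (poly_gen K i) (poly_gen K j).
  rewrite -(splitK i) -(splitK j).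
  case: (fintype.split i) => k; case: (fintype.split j) => l /=;
  by have [h1 h2 h3 h4] := bg k l; have [h5 h6 h7 h8] := poisson_gen k l;
     rewrite ?h1 ?h2 ?h3 ?h4 ?h5 ?h6 ?h7 ?h8.
have genr i g : b (poly_gen K i) g = poisson (poly_gen K i) g.
  apply/eqP; rewrite -subr_eq0; apply/eqP; move: g.
  apply: (@derivation_eq0 (fun g => b _ g - poisson _ g)).
  - by move=> c u v; rewrite r2 r1 scalerBr opprD addrACA.
  - by move=> u v; rewrite mr2 mr1; ring.
  - by move=> j; rewrite gen subrr.
move=> f g; apply/eqP; rewrite -subr_eq0; apply/eqP; move: f.
apply: (@derivation_eq0 (fun f => b f g - poisson f g)).
- by move=> c u v; rewrite l2 l1 scalerBr opprD addrACA.
- by move=> u v; rewrite ml2 ml1; ring.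
- by move=> j; rewrite genr subrr.
Qed.

End PoissonTheory.

Section Tame.
Variables (K : comNzRingType) (n : nat).

Definition symplectic_form : 'M[K]_(n + n) := block_mx 0 1%:M (- 1%:M) 0.

Definition symplectic_mx : set 'M[K]_(n + n) :=
  [set M | M^T *m symplectic_form *m M = symplectic_form].

(* Formulas shared by the tame generators of the polynomial algebra and of the
   Weyl algebra. *)
Variant tame_formula : Type :=
| Linear of 'M[K]_(n + n)
| ElementaryX of 'I_n & mpoly n K
| ElementaryP of 'I_n & mpoly n K.

Definition tame_admissible (t : tame_formula) : Prop :=
  match t with
  | Linear M => symplectic_mx M
  | ElementaryX _ f => mcoeff mnm0 f = 0
  | ElementaryP _ g => mcoeff mnm0 g = 0
  end.

(* [mmap] substitutes a family of elements for the variables, multiplying in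
   increasing order of the indices; it is only used on commuting families. *)
Definition tame_image (A : algType K) (z : 'I_(n + n) -> A) (t : tame_formula)
    (j : 'I_(n + n)) : A :=
  match t with
  | Linear M => \sum_i M i j *: z i
  | ElementaryX k f =>
      if j == xvar k then z j + mmap (in_alg A) (fun i => z (pvar i)) f else z j
  | ElementaryP k g =>
      if j == pvar k then z j + mmap (in_alg A) (fun i => z (xvar i)) g else z j
  end.

Definition has_formula (A : algType K) (z : 'I_(n + n) -> A) (t : tame_formula)
  (f : A -> A) : Prop := tame_admissible t /\ forall j, f (z j) = tame_image z t j.

Definition poly_tame_gen (t : tame_formula) :
    set (mpoly (n + n) K -> mpoly (n + n) K) :=
  [set s | symplectomorphism s /\ has_formula (@poly_gen K n) t s].

Definition weyl_tame_gen (t : tame_formula) : set (weyl K n -> weyl K n) :=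
  [set s | alg_aut s /\ has_formula (@weyl_gen K n) t s].

Definition TAutP : set (mpoly (n + n) K -> mpoly (n + n) K) :=
  generated_subgroup [set s | exists t, poly_tame_gen t s].

Definition TAutW : set (weyl K n -> weyl K n) :=
  generated_subgroup [set s | exists t, weyl_tame_gen t s].

(* A group isomorphism from TAutW to TAutP is encoded by a map on all self-maps
   of the algebras, of which only the values on TAutW matter. *)
Definition canonical_iso
    (Phi : (weyl K n -> weyl K n) -> (mpoly (n + n) K -> mpoly (n + n) K)) : Prop :=
  [/\ set_bij TAutW TAutP Phi,
      forall f g, TAutW f -> TAutW g -> Phi (f \o g) = Phi f \o Phi g
    & forall t f, weyl_tame_gen t f -> poly_tame_gen t (Phi f)].

End Tame.

Section PowerSeriesTopology.
Variables (R : realType) (K : comNzRingType) (n : nat).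

Local Open Scope ereal_scope.

(* The least degree of a nonzero homogeneous component, +oo for f = 0. *)
Definition height (f : mpoly (n + n) K) : \bar R :=
  ereal_inf [set (k%:R)%:E | k in [set k : nat | pihomog mdeg k f != 0%R]].

Definition tuple_height (f : 'I_(n + n) -> mpoly (n + n) K) : \bar R :=
  \big[Order.min/+oo]_j height (f j).

(* exp (- ht (f - g)), with exp (- oo) = 0. *)
Definition fps_dist (f g : mpoly (n + n) K -> mpoly (n + n) K) : R :=
  fine (expeR (- tuple_height (fun j => f (poly_gen K j) - g (poly_gen K j))%R)).

End PowerSeriesTopology.

(* Main.v *)
(* Since Phi is onto TAutP, it suffices to approximate sigma by tame
   symplectomorphisms. Suppose a tame tau agrees with sigma modulo terms of degree
   >= k on the generators, k >= 2. Then s = tau^-1 \o sigma moves each generator z_j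
   by some D_j of order >= k, and preservation of the bracket makes D closed modulo
   terms of degree >= k; by the Poincare lemma with Euler's homotopy,
   D_j = {H, z_j} modulo degree k + 1 for some H of order >= k + 1. The H whose
   infinitesimal action is realised modulo degree k + 1 by a tame automorphism form
   a linear space. It contains the powers l ^ (k + 1) of linear forms l with
   {l, p_0} = -1, because such an l is the image of p_0 under a symplectic
   transvection, and p_0 ^ (k + 1) is the Hamiltonian of an elementary
   transformation. These powers span the monomials of degree k + 1 by polarization:
   varying l along a generator other than x_0 keeps {l, p_0} = -1, and at the end
   l = x_0. *)

Require Import Defs.
From mathcomp Require Import all_boot all_order all_algebra.
From mathcomp Require Import boolp classical_sets functions reals constructive_ereal.
From mathcomp Require Import ereal topology normedtype sequences exp complex.
From mathcomp Require Import ring.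
From mathcomp Require Import -(notations) mpoly.

Set Implicit Arguments.
Unset Strict Implicit.
Unset Printing Implicit Defensive.

Import Order.TTheory GRing.Theory Num.Theory.
Import numFieldNormedType.Exports.
Local Open Scope classical_set_scope.
Local Open Scope ring_scope.

(** * Order of vanishing at the origin *)

Section VanishingOrder.
Variable K : comNzRingType.

(** Membership in the [k]-th power of the ideal generated by the variables. As a lower bound on the
    height it holds for 0 at every [k], so no infinite value has to be handled. *)
Definition ord_ge n (k : nat) (f : mpoly n K) : Prop :=
  forall m, (mdeg m < k)%N -> mcoeff m f = 0.

Section Basics.
Variable n : nat.
Local Notation P := (mpoly n K).
Implicit Types (f g : P) (k l : nat).

Lemma ord_geW k l f : (l <= k)%N -> ord_ge k f -> ord_ge l f.
Proof. by move=> lk fk m ml; apply: fk; apply: leq_trans lk. Qed.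

Lemma ord_ge_lin k c f g :
  ord_ge k f -> ord_ge k g -> ord_ge k (c *: f + g).
Proof. by move=> fk gk m mk; rewrite mcoeffD mcoeffZ fk // gk // mulr0 addr0. Qed.

Lemma ord_ge00 k : ord_ge k (0 : P).
Proof. by move=> m _; rewrite mcoeff0. Qed.

Lemma ord_geZ k c f : ord_ge k f -> ord_ge k (c *: f).
Proof. by move=> fk; rewrite -[_ *: _]addr0; apply: ord_ge_lin => //; apply: ord_ge00. Qed.

Lemma ord_geD k f g : ord_ge k f -> ord_ge k g -> ord_ge k (f + g).
Proof. by move=> fk; rewrite -[f]scale1r; apply: ord_ge_lin. Qed.

Lemma ord_geN k f : ord_ge k f -> ord_ge k (- f).
Proof. by rewrite -scaleN1r; apply: ord_geZ. Qed.

Lemma ord_geB k f g : ord_ge k f -> ord_ge k g -> ord_ge k (f - g).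
Proof. by move=> fk /ord_geN; apply: ord_geD. Qed.

Lemma ord_ge_sum k (I : Type) (r : seq I) (Q : pred I) (F : I -> P) :
  (forall i, Q i -> ord_ge k (F i)) -> ord_ge k (\sum_(i <- r | Q i) F i).
Proof.
move=> Fk; elim/big_ind: _ => //; first exact: ord_ge00.
by move=> ? ?; apply: ord_geD.
Qed.

Lemma ord_ge0 f : ord_ge 0 f.
Proof. by []. Qed.

Lemma ord_geM k l f g : ord_ge k f -> ord_ge l g -> ord_ge (k + l) (f * g).
Proof.
move=> fk gl m mkl; rewrite mcoeffM; apply: big1 => -[a b] /= /eqP /(congr1 mdeg).
rewrite mdegD => mE; case: (ltnP (mdeg a) k) => [ak|ka].
  by rewrite fk // mul0r.
rewrite [mcoeff b g]gl ?mulr0 // -(ltn_add2l k); apply: leq_ltn_trans mkl.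
by apply: leq_trans (eq_leq (esym mE)); rewrite leq_add2r.
Qed.

Lemma ord_geMl k f g : ord_ge k g -> ord_ge k (f * g).
Proof. by move=> gk; rewrite -[k]add0n; apply: ord_geM. Qed.

Lemma ord_geX k f i : ord_ge k f -> ord_ge (k * i) (f ^+ i).
Proof.
move=> fk; elim: i => [|i IH]; first by rewrite muln0; apply: ord_ge0.
by rewrite mulnS exprS; apply: ord_geM.
Qed.

Lemma ord_ge_mderiv k i f : ord_ge k.+1 f -> ord_ge k (mderiv i f).
Proof. by move=> fk m mk; rewrite mcoeff_deriv fk ?mul0rn // mdegD mdeg1 addn1. Qed.

Lemma ord_ge_monom m : ord_ge (mdeg m) (mpolyX K m : P).
Proof. by move=> m' lt; rewrite mcoeffX; case: eqP lt => // ->; rewrite ltnn. Qed.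

Lemma ord_ge1_mcoeff0 f : ord_ge 1 f <-> mcoeff mnm0 f = 0.
Proof.
split=> [|f0 m]; first by apply; rewrite mdeg0.
by rewrite ltnS leqn0 mdeg_eq0 => /eqP ->.
Qed.

End Basics.

(** A monomial of degree d becomes a product of d factors without constant term, hence has order at
    least d after substitution. *)
Lemma ord_ge_mmap n n' k (h : 'I_n -> mpoly n' K) f :
  (forall i, ord_ge 1 (h i)) -> ord_ge k f ->
  ord_ge k (mmap (in_alg (mpoly n' K)) h f).
Proof.
move=> h1 fk; rewrite /mmap; apply: ord_ge_sum => m _.
case: (ltnP (mdeg m) k) => [mk|km].
  by rewrite fk //= scale0r mul0r; apply: ord_ge00.
apply/ord_geMl; apply: ord_geW km _; rewrite mdegE /mmap1.
elim/big_ind2: _ => [|? ? ? ? ? ?|i _]; first exact: ord_ge0.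
  exact: ord_geM.
by rewrite -{1}[m i]mul1n; apply: ord_geX.
Qed.

End VanishingOrder.

(** * Endomorphisms of the polynomial algebra as substitutions *)

Section PolynomialEndomorphisms.
Variables (K : comNzRingType) (n : nat).
Local Notation P := (mpoly (n + n) K).
Local Notation z := (@poly_gen K n).

(** Reduces identities and congruences between algebra maps and derivations to the generators. *)
Lemma poly_gen_ind (Q : P -> Prop) : Q 1 ->
  (forall c f g, Q f -> Q g -> Q (c *: f + g)) ->
  (forall f g, Q f -> Q g -> Q (f * g)) ->
  (forall j, Q (z j)) -> forall f, Q f.
Proof.
move=> Q1 Qlin QM Qz f.
have Q0 : Q 0 by rewrite -[0](addNr (1 : P)) -scaleN1r; apply: Qlin.
elim/mpolyind: f => [//|c m p _ _ IH]; apply: Qlin => //.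
rewrite mpolyXE_id; elim/big_ind: _ => // i _.
by elim: (m i) => [|k IHk]; rewrite ?expr0 // exprS; apply: QM => //; apply: Qz.
Qed.

Lemma alg_hom_ext (A : algType K) (s t : P -> A) : alg_hom s -> alg_hom t ->
  (forall j, s (z j) = t (z j)) -> s = t.
Proof.
move=> [sl [s1 sM]] [tl [t1 tM]] st; apply/funext; apply: poly_gen_ind => //.
- by rewrite s1 t1.
- by move=> c f g sf sg; rewrite sl tl sf sg.
- by move=> f g sf sg; rewrite sM tM sf sg.
Qed.

Definition poly_hom (h : 'I_(n + n) -> P) : P -> P := mmap (in_alg P) h.

Lemma poly_hom_alg_hom h : alg_hom (poly_hom h).
Proof.
split=> [c f g|]; first by rewrite /poly_hom mmapD mmapZ /= mulr_algl.
split=> [|f g]; first by rewrite /poly_hom -mpolyC1 mmapC /= scale1r.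
exact: (rmorphM (mmap (in_alg P) h)).
Qed.

Lemma poly_hom_gen h j : poly_hom h (z j) = h j.
Proof. by rewrite /poly_hom /poly_gen mmapX mmap1U. Qed.

Lemma alg_homE s : alg_hom s -> s = poly_hom (s \o z).
Proof.
by move=> sh; apply: alg_hom_ext => // [|j]; [exact: poly_hom_alg_hom | rewrite poly_hom_gen].
Qed.

Lemma ord_ge_alg_hom k (s : P -> P) f : alg_hom s -> origin_preserving s ->
  ord_ge k f -> ord_ge k (s f).
Proof.
move=> sh s0; rewrite (alg_homE sh); apply: ord_ge_mmap => j.
by apply/ord_ge1_mcoeff0; apply: s0.
Qed.

Lemma alg_homB (s : P -> P) : alg_hom s -> {morph s : f g / f - g}.
Proof. by move=> sh f g; rewrite alg_homD // -scaleN1r alg_homZ // scaleN1r. Qed.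

Lemma alg_homX (s : P -> P) f k : alg_hom s -> s (f ^+ k) = s f ^+ k.
Proof.
by move=> [_ [s1 sM]]; elim: k => [|k IH]; rewrite ?expr0 // !exprS sM IH.
Qed.

Lemma alg_hom_comp (s t : P -> P) : alg_hom s -> alg_hom t -> alg_hom (s \o t).
Proof.
move=> [sl [s1 sM]] [tl [t1 tM]]; split=> [c f g|] /=; first by rewrite tl sl.
by split=> [|f g] /=; rewrite ?t1 ?tM.
Qed.

Lemma alg_hom_inv (s t : P -> P) : alg_hom s -> cancel s t -> cancel t s -> alg_hom t.
Proof.
move=> [sl [s1 sM]] st ts; split=> [c f g|].
  by apply: (can_inj st); rewrite sl !ts.
by split=> [|f g]; apply: (can_inj st); rewrite ?s1 ?sM !ts.
Qed.

End PolynomialEndomorphisms.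

(** * Calculus of the Poisson bracket *)

Section PoissonBracket.
Variables (K : comNzRingType) (n : nat).
Local Notation P := (mpoly (n + n) K).
Local Notation z := (@poly_gen K n).
Local Notation J := (symplectic_form K n).
Implicit Types (f g : P) (s t : P -> P) (h : 'I_(n + n) -> P).

Lemma linear_fun_sum (D : P -> P) (I : Type) (r : seq I) (c : I -> K) (F : I -> P) :
  linear D -> D (\sum_(i <- r) c i *: F i) = \sum_(i <- r) c i *: D (F i).
Proof.
move=> Dl; elim: r => [|i r IH]; last by rewrite !big_cons Dl IH.
by rewrite !big_nil; have := Dl (-1) 0 0; rewrite !scaleN1r !addNr.
Qed.

Lemma poisson_linl g : linear ((@poisson K n)^~ g).
Proof. by have [] := @poisson_biderivation K n. Qed.

Lemma poisson_linr f : linear (poisson f).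
Proof. by have [] := @poisson_biderivation K n. Qed.

Lemma poissonMl f g (h : P) : poisson (f * g) h = f * poisson g h + poisson f h * g.
Proof. by have [] := @poisson_biderivation K n. Qed.

Lemma poissonMr f g (h : P) : poisson h (f * g) = f * poisson h g + poisson h f * g.
Proof. by have [] := @poisson_biderivation K n. Qed.

Lemma poissonC f g : poisson f g = - poisson g f.
Proof. by rewrite /poisson -sumrN; apply: eq_bigr => i _; ring. Qed.

Lemma poissonff f : poisson f f = 0.
Proof. by rewrite /poisson big1 // => i _; ring. Qed.

Lemma poisson0l g : poisson 0 g = 0.
Proof. by have := poisson_linl g (-1) 0 0; rewrite !scaleN1r !addNr. Qed.

Lemma poisson0r f : poisson f 0 = 0.
Proof. by rewrite poissonC poisson0l oppr0. Qed.

Lemma poissonDl f g (h : P) : poisson (f + g) h = poisson f h + poisson g h.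
Proof. by have := poisson_linl h 1 f g; rewrite !scale1r. Qed.

Lemma poissonDr f g (h : P) : poisson h (f + g) = poisson h f + poisson h g.
Proof. by have := poisson_linr h 1 f g; rewrite !scale1r. Qed.

Lemma poissonZl c f g : poisson (c *: f) g = c *: poisson f g.
Proof. by have := poisson_linl g c f 0; rewrite !addr0 poisson0l addr0. Qed.

Lemma poissonZr c f g : poisson f (c *: g) = c *: poisson f g.
Proof. by have := poisson_linr f c g 0; rewrite !addr0 poisson0r addr0. Qed.

Lemma poissonNl f g : poisson (- f) g = - poisson f g.
Proof. by rewrite -scaleN1r poissonZl scaleN1r. Qed.

Lemma poissonNr f g : poisson f (- g) = - poisson f g.
Proof. by rewrite -scaleN1r poissonZr scaleN1r. Qed.

Lemma poisson1r f : poisson f 1 = 0.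
Proof.
have := poissonMr 1 1 f; rewrite !mulr1 mul1r => /eqP.
by rewrite -subr_eq0 opprD addNKr oppr_eq0 => /eqP.
Qed.

Lemma poisson1l f : poisson 1 f = 0.
Proof. by rewrite poissonC poisson1r oppr0. Qed.

Lemma poissonXl f g k : poisson (f ^+ k.+1) g = k.+1%:R *: (f ^+ k * poisson f g).
Proof.
elim: k => [|k IH]; first by rewrite expr1 expr0 mul1r scale1r.
rewrite exprS poissonMl IH -[k.+2]addn1 natrD scalerDl scale1r exprS.
by rewrite -scalerAr; congr (_ *: _ + _); ring.
Qed.

Lemma poisson_genr f (i : 'I_n) :
  poisson f (z (xvar i)) = mderiv (pvar i) f /\
  poisson f (z (pvar i)) = - mderiv (xvar i) f.
Proof.
by split; rewrite /poisson (bigD1 i) //= big1 ?addr0 => [|k ki];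
  rewrite !mderiv_gen ?eq_lrshift ?eq_rlshift ?eq_lshift ?eq_rshift ?eqxx ?(negbTE ki)
    ?mulr1 ?mulr0 ?subr0 ?sub0r.
Qed.

Lemma ord_ge_poissonl k f g : ord_ge k.+1 f -> ord_ge k (poisson f g).
Proof.
move=> fk; apply: ord_ge_sum => i _; rewrite ![mderiv _ f * _]mulrC.
by apply: ord_geB; apply/ord_geMl/ord_ge_mderiv.
Qed.

Lemma ord_ge_poisson k l f g :
  ord_ge k.+1 f -> ord_ge l.+1 g -> ord_ge (k + l) (poisson f g).
Proof.
move=> fk gl; apply: ord_ge_sum => i _.
by apply: ord_geB; apply: ord_geM; apply: ord_ge_mderiv.
Qed.

(** The sign comes from the convention {p_i, x_i} = 1, while [J] has entry 1 at the position (x_i,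
    p_i). *)
Lemma poisson_gen_form a b : poisson (z a) (z b) = mpolyC _ (- J a b).
Proof.
rewrite -(splitK a) -(splitK b).
case: (fintype.split a) => i; case: (fintype.split b) => j /=;
  have [px xp xx pp] := @poisson_gen K n i j;
  rewrite /symplectic_form ?block_mxEul ?block_mxEur ?block_mxEdl ?block_mxEdr !mxE.
- by rewrite [LHS]xx oppr0 mpolyC0.
- by rewrite [LHS]xp mpolyCN; case: eqP; rewrite ?mpolyC1 ?mpolyC0.
- by rewrite [LHS]px opprK; case: eqP; rewrite ?mpolyC1 ?mpolyC0.
- by rewrite [LHS]pp oppr0 mpolyC0.
Qed.

(** With one argument fixed, both sides are derivations along [s] in the other, so agreement spreads
    from the generators to all polynomials, first in [f] and then in [g]. *)
Lemma poisson_alg_hom s : alg_hom s ->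
  (forall a b, s (poisson (z a) (z b)) = poisson (s (z a)) (s (z b))) ->
  forall f g, s (poisson f g) = poisson (s f) (s g).
Proof.
move=> sh sz; have [sl [s1 sM]] := sh.
have szr f b : s (poisson f (z b)) = poisson (s f) (s (z b)).
  move: f; apply: poly_gen_ind => // [|c f g sf sg|f g sf sg].
  - by rewrite s1 !poisson1l alg_hom0.
  - by rewrite poisson_linl !sl sf sg poisson_linl.
  - by rewrite poissonMl alg_homD // !sM sf sg poissonMl.
move=> f; apply: poly_gen_ind => // [|c g h sg sh'|g h sg sh'].
- by rewrite s1 !poisson1r alg_hom0.
- by rewrite poisson_linr !sl sg sh' poisson_linr.
- by rewrite poissonMr alg_homD // !sM sg sh' poissonMr.
Qed.

Lemma symplectomorphism_poly_hom (h h' : 'I_(n + n) -> P) :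
  (forall j, poly_hom h (h' j) = z j) -> (forall j, poly_hom h' (h j) = z j) ->
  (forall a b, poisson (h a) (h b) = poisson (z a) (z b)) ->
  symplectomorphism (poly_hom h).
Proof.
move=> hh' h'h hP; have hh := poly_hom_alg_hom h; have hh2 := poly_hom_alg_hom h'.
split; last first.
  apply: poisson_alg_hom => // a b; rewrite !poly_hom_gen hP poisson_gen_form.
  by rewrite /poly_hom mmapC /= alg_mpolyC.
split=> //; exists (poly_hom h') => f.
  suff: poly_hom h' \o poly_hom h = id by move/(congr1 (fun F => F f)).
  by apply: alg_hom_ext => [||j] //=; [exact: alg_hom_comp|rewrite poly_hom_gen].
suff: poly_hom h \o poly_hom h' = id by move/(congr1 (fun F => F f)).
by apply: alg_hom_ext => [||j] //=; [exact: alg_hom_comp|rewrite poly_hom_gen].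
Qed.

(** * Linear and elementary tame automorphisms *)

Definition linear_form (v : 'I_(n + n) -> K) : P := \sum_i v i *: z i.

Lemma ord_ge_gen j : ord_ge 1 (z j).
Proof. by have := @ord_ge_monom K (n + n) (mnm1 j); rewrite mdeg1. Qed.

Lemma ord_ge_linear_form v : ord_ge 1 (linear_form v).
Proof. by apply: ord_ge_sum => i _; apply/ord_geZ/ord_ge_gen. Qed.

Lemma poly_hom_linear_form h v : poly_hom h (linear_form v) = \sum_i v i *: h i.
Proof.
rewrite /linear_form linear_fun_sum; last exact: (poly_hom_alg_hom h).1.
by apply: eq_bigr => i _; rewrite poly_hom_gen.
Qed.

Lemma poisson_linear_form (u v : 'I_(n + n) -> K) :
  poisson (linear_form u) (linear_form v) =
  mpolyC _ (- \sum_i \sum_j u i * J i j * v j).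
Proof.
rewrite /linear_form (linear_fun_sum _ _ _ (poisson_linl _)).
rewrite -sumrN (raddf_sum (@mpolyC (n + n) K)); apply: eq_bigr => i _.
rewrite (linear_fun_sum _ _ _ (poisson_linr _)) -sumrN (raddf_sum (@mpolyC (n + n) K)).
rewrite scaler_sumr; apply: eq_bigr => j _.
by rewrite poisson_gen_form -!mul_mpolyC -!mpolyCM; congr mpolyC; ring.
Qed.

(** Comparing the constant brackets of the columns of [M] with those of the generators gives M^T J M
    = J, and this already makes [M] invertible. *)
Lemma linear_tame (M : 'M[K]_(n + n)) (h := fun j => linear_form (M^~ j)) :
  (forall a b, poisson (h a) (h b) = poisson (z a) (z b)) -> TAutP (poly_hom h).
Proof.
move=> hP; have MJ : symplectic_mx M.
  apply/matrixP => a b; have := hP a b.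
  rewrite poisson_linear_form poisson_gen_form => /(congr1 (mcoeff mnm0)).
  rewrite !mcoeffC eqxx !mulr1 => /oppr_inj <-; rewrite mxE exchange_big /=.
  by apply: eq_bigr => i _; rewrite mxE mulr_suml; apply: eq_bigr => j _; rewrite mxE.
have JJ : J *m J = - 1%:M.
  rewrite /symplectic_form mulmx_block !mul0mx !mulmx0 !mul1mx !mulmx1 addr0 !add0r.
  rewrite scalar_mx_block opp_block_mx !oppr0 ?addr0. by [].
(* From M^T J M = J and J^2 = -1 it follows that N M = - J J = 1. *)
pose N := - (J *m M^T *m J).
have NM : N *m M = 1%:M.
  by rewrite /N mulNmx -!mulmxA [M^T *m _]mulmxA MJ JJ opprK.
have MN := mulmx1C NM.
have inv (A B : 'M[K]_(n + n)) j : A *m B = 1%:M ->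
    poly_hom (fun j => linear_form (A^~ j)) (linear_form (B^~ j)) = z j.
  move=> AB; rewrite poly_hom_linear_form /linear_form.
  transitivity (\sum_i (A *m B) i j *: z i).
    under eq_bigr => i _ do rewrite scaler_sumr.
    rewrite exchange_big; apply: eq_bigr => i _ /=; rewrite mxE scaler_suml.
    by apply: eq_bigr => k _; rewrite scalerA mulrC.
  rewrite AB (bigD1 j) //= big1 => [|i ij]; rewrite mxE.
    by rewrite eqxx scale1r addr0.
  by rewrite (negbTE ij) scale0r.
apply: GenIn; exists (Linear M); split; last by split=> // j; rewrite poly_hom_gen.
apply: (@symplectomorphism_poly_hom _ (fun j => linear_form (N^~ j))) => // j; exact: inv.
Qed.

(** The added term involves p_i alone, so it commutes with every generator except x_i and the
    canonical brackets survive. Changing the sign of [c] gives the inverse, and the exponent [d.+1]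
    rules out a constant term. *)
Lemma elementary_tame (i : 'I_n) (c : K) (d : nat)
    (h := fun j => if j == xvar i then z j + c *: z (pvar i) ^+ d.+1 else z j) :
  TAutP (poly_hom h).
Proof.
pose e c j : P := if j == xvar i then z j + c *: z (pvar i) ^+ d.+1 else z j.
have pE c' j : j != xvar i -> poly_hom (e c') (z j) = z j.
  by move=> ji; rewrite poly_hom_gen /e (negbTE ji).
have px : pvar i != xvar i by rewrite eq_rlshift.
have eK c1 c2 j : c1 + c2 = 0 -> poly_hom (e c1) (e c2 j) = z j.
  move=> c12; have [eL _] := poly_hom_alg_hom (e c1).
  rewrite {2}/e; case: eqP => [->|/eqP/pE //].
  rewrite addrC eL (alg_homX _ _ (poly_hom_alg_hom _)) pE //.
  rewrite poly_hom_gen /e eqxx addrCA -scalerDl addrC [c2 + _]addrC c12.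
  by rewrite scale0r add0r.
have pz b : b != xvar i -> poisson (z (pvar i) ^+ d.+1) (z b) = 0.
  move=> bi; rewrite poissonXl [X in _ * X](_ : _ = 0) ?mulr0 ?scaler0 //.
  move: bi; rewrite -(splitK b); case: (fintype.split b) => k /=.
    rewrite eq_lshift eq_sym => /negbTE ik.
    by have [-> _ _ _] := @poisson_gen K n i k; rewrite ik.
  by have [_ _ _ ->] := @poisson_gen K n i k.
apply: GenIn; exists (ElementaryX i (c *: mpolyX K (mnm1 i) ^+ d.+1)); split; last first.
  split=> [|j]; last first.
    rewrite poly_hom_gen /h /=; case: eqP => // _; congr (_ + _).
    by rewrite mmapZ rmorphXn /= mmapX mmap1U mulr_algl.
  apply/ord_ge1_mcoeff0/ord_geZ; rewrite exprS mulrC; apply: ord_geMl.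
  by have := @ord_ge_monom K n (mnm1 i); rewrite mdeg1.
apply: (@symplectomorphism_poly_hom _ (e (- c))) => [j|j|a b].
- by apply: eK; rewrite subrr.
- by apply: (eK (- c) c); rewrite addNr.
rewrite /h; case: (eqVneq a (xvar i)) (eqVneq b (xvar i)) => [->|ai] [->|bi] //.
- by rewrite !poissonff.
- by rewrite poissonDl poissonZl pz // scaler0 addr0.
- by rewrite poissonDr poissonZr [X in _ *: X]poissonC pz // oppr0 scaler0 addr0.
Qed.

(** * The group of origin-preserving symplectomorphisms *)

Definition origin_symplecto s := symplectomorphism s /\ origin_preserving s.

(** If c is the constant term of t z_j, then [s] sends t z_j - c to z_j - c. Since [s] keeps the
    constant term zero, c = 0. *)
Lemma origin_symplecto_inv s t : origin_symplecto s -> cancel s t -> cancel t s ->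
  origin_symplecto t.
Proof.
move=> [[[sh _] sP] s0] st ts; have th := alg_hom_inv sh st ts; split.
  split; first by split=> //; exists s.
  by move=> f g; apply: (can_inj st); rewrite sP !ts.
move=> j; set f := t _.
have f0 : ord_ge 1 (f - mpolyC _ (mcoeff mnm0 f)).
  by apply/ord_ge1_mcoeff0; rewrite mcoeffB mcoeffC eqxx mulr1 subrr.
have /(_ mnm0) := ord_ge_alg_hom sh s0 f0.
rewrite mdeg0 alg_homB // {1}/f ts -alg_mpolyC alg_homZ // sh.2.1 alg_mpolyC.
rewrite mcoeffB (ord_ge_gen j) ?mdeg0 // mcoeffC eqxx mulr1 sub0r => /(_ isT).
by move/eqP; rewrite oppr_eq0 => /eqP.
Qed.

Lemma origin_symplecto_comp s t : origin_symplecto s -> origin_symplecto t ->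
  origin_symplecto (s \o t).
Proof.
move=> [[[sh sb] sP] s0] [[[th tb] tP] t0]; split.
  split; first by split; [exact: alg_hom_comp | exact: bij_comp].
  by move=> f g /=; rewrite tP sP.
move=> j; apply/ord_ge1_mcoeff0/(ord_ge_alg_hom sh s0).
by apply/ord_ge1_mcoeff0/t0.
Qed.

(** This is what allows tame maps and their inverses to transport orders of vanishing. *)
Lemma TAutP_origin_symplecto s : TAutP s -> origin_symplecto s.
Proof.
elim=> {s} [s [t [sS [ta tE]]]||s t _ sS _ tS|s t _ sS st ts].
- split=> // j; rewrite tE; apply/ord_ge1_mcoeff0.
  case: t ta {tE} => [M _|k f f0|k f f0] /=; first exact: ord_ge_linear_form.
    case: ifP => _; last exact: ord_ge_gen.
    apply: ord_geD; first exact: ord_ge_gen.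
    by apply: ord_ge_mmap => [i|]; [exact: ord_ge_gen | apply/ord_ge1_mcoeff0].
  case: ifP => _; last exact: ord_ge_gen.
  apply: ord_geD; first exact: ord_ge_gen.
  by apply: ord_ge_mmap => [i|]; [exact: ord_ge_gen | apply/ord_ge1_mcoeff0].
- split; last by move=> j /=; apply/ord_ge1_mcoeff0/ord_ge_gen.
  by split=> //; split=> //; exists id.
- exact: origin_symplecto_comp.
- exact: (origin_symplecto_inv sS st ts).
Qed.

End PoissonBracket.

(** Characteristic zero in the form that permits the divisions in Euler's homotopy and in
    polarization. *)
Definition nats_invertible (K : comNzRingType) :=
  forall m, exists u : K, u * m.+1%:R = 1.

(** * The Poincare lemma modulo higher order *)

Section HomogeneousPoincare.
Variables (K : comNzRingType) (N : nat).
Local Notation P := (mpoly N K).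
Local Notation x i := (mpolyX K (mnm1 i) : P).

(** Euler's operator multiplies a monomial of degree d by d, so the difference cancels exactly in
    degree k. *)
Lemma euler_mod k (f : P) : ord_ge k f ->
  ord_ge k.+1 (\sum_i x i * mderiv i f - k%:R *: f).
Proof.
move=> fk.
have eulerX m : \sum_i x i * mderiv i (mpolyX K m) = (mdeg m)%:R *: mpolyX K m.
  rewrite mdegE natr_sum scaler_suml; apply: eq_bigr => i _.
  rewrite mderivX -scalerAr -mpolyXD; case: (posnP (m i)) => [->|mi].
    by rewrite !scale0r.
  congr (_ *: mpolyX K _); apply/mnmP => j; rewrite mnmDE mnmBE mnm1E.
  by case: eqP => [<-|_]; rewrite ?subn0 // subnKC.
have -> : \sum_i x i * mderiv i f =
    \sum_(m <- msupp f) mcoeff m f *: ((mdeg m)%:R *: mpolyX K m).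
  rewrite {1}[f]mpolyE.
  under eq_bigr => i _ do rewrite raddf_sum mulr_sumr.
  rewrite exchange_big; apply: eq_bigr => m _ /=; rewrite -eulerX scaler_sumr.
  by apply: eq_bigr => i _; rewrite mderivZ scalerAr.
rewrite {3}[f]mpolyE scaler_sumr -sumrB; apply: ord_ge_sum => m _.
rewrite !scalerA -scalerBl [k%:R * _]mulrC -mulrBr.
have [mk|km|->] := ltngtP (mdeg m) k; last by rewrite subrr mulr0 scale0r; apply: ord_ge00.
  by rewrite fk // mul0r scale0r; apply: ord_ge00.
by apply: ord_geZ; apply: ord_geW km _; apply: ord_ge_monom.
Qed.

(** Take H = (k+1)^-1 sum_a x_a G_a. The b-th derivative of the sum is G_b + sum_a x_a d_b G_a.
    Closedness exchanges d_b G_a for d_a G_b at a cost of order k, raised to k+1 by the factor x_a,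
    and Euler's identity then yields (k+1) G_b. *)
Lemma poincare_mod k (G : 'I_N -> P) : nats_invertible K -> (forall a, ord_ge k (G a)) ->
  (forall a b, ord_ge k (mderiv a (G b) - mderiv b (G a))) ->
  exists2 H : P, ord_ge k.+1 H & forall b, ord_ge k.+1 (mderiv b H - G b).
Proof.
move=> /(_ k)[u uk] Gk Gc.
have mderivxx a b : mderiv a (x b) = (a == b)%:R.
  rewrite mderivX mnm1E eq_sym; case: eqP => [->|_]; last by rewrite scale0r.
  rewrite scale1r (_ : mnm_sub _ _ = mnm0) ?mpolyX0 //.
  by apply/mnmP => j; rewrite mnmBE subnn mnm0E.
have x1 a : ord_ge 1 (x a) by have := @ord_ge_monom K N (mnm1 a); rewrite mdeg1.
exists (u *: \sum_a x a * G a).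
  by apply/ord_geZ/ord_ge_sum => a _; rewrite -add1n; apply: ord_geM.
move=> b; rewrite mderivZ -[X in _ - X]scale1r -uk -scalerA -scalerBr.
apply: ord_geZ; rewrite raddf_sum /=.
have -> : \sum_a mderiv b (x a * G a) - k.+1%:R *: G b =
    \sum_a x a * (mderiv b (G a) - mderiv a (G b)) +
    (\sum_a x a * mderiv a (G b) - k%:R *: G b).
  rewrite addrA -big_split /= -[k.+1]addn1 natrD scalerDl scale1r opprD addrA addrAC.
  congr (_ - _); rewrite -[X in _ - X](_ : \sum_a mderiv b (x a) * G a = _).
    rewrite -sumrB; apply: eq_bigr => a _; rewrite mderivM; ring.
  rewrite (bigD1 b) //= big1 ?addr0 => [|a ab].
    by rewrite (mderivxx b b) eqxx mul1r.
  by rewrite mderivxx eq_sym (negbTE ab) mul0r.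
apply: ord_geD; last exact: euler_mod.
by apply: ord_ge_sum => a _; rewrite -add1n; apply: ord_geM.
Qed.

End HomogeneousPoincare.

(** * Infinitesimal symplectomorphisms and their Hamiltonians *)

Section HamiltonianApproximation.
Variables (K : comNzRingType) (n : nat).
Local Notation P := (mpoly (n + n) K).
Local Notation z := (@poly_gen K n).
Implicit Types (f g H : P) (s t : P -> P).

(** Since {H, x_i} = dH/dp_i and {H, p_i} = - dH/dx_i, the gradient of [H] is prescribed: it is the
    1-form [G] dual to the vector field [D]. Infinitesimal preservation of the bracket says that
    this form is closed. *)
Lemma hamiltonian_mod k (D : 'I_(n + n) -> P) : nats_invertible K ->
  (forall a, ord_ge k (D a)) ->
  (forall a b, ord_ge k (poisson (D a) (z b) + poisson (z a) (D b))) ->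
  exists2 H : P, ord_ge k.+1 H & forall a, ord_ge k.+1 (poisson H (z a) - D a).
Proof.
move=> natK Dk Dc.
pose G (a : 'I_(n + n)) : P :=
  match fintype.split a with inl i => - D (pvar i) | inr i => D (xvar i) end.
have Gx i : G (xvar i) = - D (pvar i).
  by rewrite /G /xvar (unsplitK (inl i : 'I_n + 'I_n)).
have Gp i : G (pvar i) = D (xvar i).
  by rewrite /G /pvar (unsplitK (inr i : 'I_n + 'I_n)).
have Gk a : ord_ge k (G a) by rewrite /G; case: fintype.split => i //; apply: ord_geN.
have xE f i : mderiv (xvar i) f = - poisson f (z (pvar i)).
  by have [_ ->] := poisson_genr f i; rewrite opprK.
have pE f i : mderiv (pvar i) f = poisson f (z (xvar i)).
  by have [-> _] := poisson_genr f i.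
have [a b|H Hk HG] := poincare_mod natK Gk; last first.
  exists H => // a; rewrite -(splitK a); case: (fintype.split a) => i /=.
    by rewrite -pE -[D _]Gp; apply: HG.
  rewrite -[_ - _]opprK opprB addrC -xE; apply: ord_geN.
  by rewrite -[D _]opprK -Gx; apply: HG.
rewrite -(splitK a) -(splitK b).
case: (fintype.split a) => i; case: (fintype.split b) => j /=;
  rewrite ?Gx ?Gp ?xE ?pE ?poissonNl ?opprK.
- rewrite [poisson (D (pvar i)) _]poissonC opprK; exact: Dc.
- rewrite [poisson (D (pvar i)) _]poissonC -opprD; apply: ord_geN; exact: Dc.
- rewrite [poisson (D (pvar j)) _]poissonC opprK addrC; exact: Dc.
- rewrite [poisson (D (xvar i)) _]poissonC opprK; exact: Dc.
Qed.

(** To leading order, [s] is the time-one flow of [H]. Quantifying over all [f], not only the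
    generators, makes composition and conjugation direct. *)
Definition ham_approx k H s := forall f, ord_ge k.+1 (s f - f - poisson H f).

(** The map id + {H, -} fails to be multiplicative only by {H, f} {H, g}, whose order is at least
    2k, hence at least k+1. *)
Lemma ham_approx_gen k H s : (1 < k)%N -> alg_hom s -> ord_ge k.+1 H ->
  (forall j, ord_ge k.+1 (s (z j) - z j - poisson H (z j))) -> ham_approx k H s.
Proof.
move=> k1 sh Hk sz; apply: poly_gen_ind => // [|c f g sf sg|f g sf sg].
- by rewrite sh.2.1 poisson1r subrr subr0; apply: ord_ge00.
- rewrite sh.1 poisson_linr.
  have -> : c *: s f + s g - (c *: f + g) - (c *: poisson H f + poisson H g) =
    c *: (s f - f - poisson H f) + (s g - g - poisson H g) by rewrite !scalerBr; ring.
  exact: ord_ge_lin.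
rewrite sh.2.2 poissonMr.
have -> : s f * s g - f * g - (f * poisson H g + poisson H f * g) =
  poisson H f * poisson H g + (s f - f - poisson H f) * s g +
  (f + poisson H f) * (s g - g - poisson H g) by ring.
apply: ord_geD; last exact: ord_geMl.
apply: ord_geD; last by rewrite mulrC; apply: ord_geMl.
apply: (@ord_geW _ _ (k + k)); last by apply: ord_geM; apply: ord_ge_poissonl.
by rewrite -addn1 leq_add2l ltnW.
Qed.

(** Hamiltonians add under composition because the cross term {H1, s2 f - f} has order at least
    2k-1, which is at least k+1 for k >= 2. *)
Lemma ham_approx_comp k H1 H2 s1 s2 : (1 < k)%N -> ord_ge k.+1 H1 -> ord_ge k.+1 H2 ->
  ham_approx k H1 s1 -> ham_approx k H2 s2 -> ham_approx k (H1 + H2) (s1 \o s2).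
Proof.
move=> k1 H1k H2k s1H s2H f /=; set g := s2 f.
have -> : s1 g - f - poisson (H1 + H2) f =
    (s1 g - g - poisson H1 g) + (g - f - poisson H2 f) + poisson H1 (g - f).
  by rewrite poissonDl poissonDr poissonNr; ring.
apply: ord_geD; first by apply: ord_geD; [exact: s1H | exact: s2H].
have gf : ord_ge k (g - f).
  rewrite -[g - f](subrK (poisson H2 f)); apply: ord_geD; last exact: ord_ge_poissonl.
  exact: ord_geW (s2H f).
case: k k1 gf {s1H s2H H2k} H1k => [//|k] k1 gf H1k.
apply: ord_geW (ord_ge_poisson H1k gf).
by rewrite -addn1 leq_add2l.
Qed.

Lemma ham_approx_conj k H s t t' : origin_symplecto t -> cancel t' t ->
  ham_approx k H s -> ham_approx k (t H) (t \o s \o t').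
Proof.
move=> [[[th _] tP] t0] t'K sH f /=; rewrite -{2 3}[f]t'K -tP -!alg_homB //.
exact: ord_ge_alg_hom.
Qed.

(** The quantification over the scalar [c] makes these Hamiltonians closed under linear
    combinations. *)
Definition tame_hamiltonian k H :=
  ord_ge k.+1 H /\ forall c, exists2 s, TAutP s & ham_approx k (c *: H) s.

Lemma tame_hamiltonian_lin k c H1 H2 : (1 < k)%N ->
  tame_hamiltonian k H1 -> tame_hamiltonian k H2 -> tame_hamiltonian k (c *: H1 + H2).
Proof.
move=> k1 [H1k tH1] [H2k tH2]; split=> [|d]; first exact: ord_ge_lin.
have [s1 s1t s1H] := tH1 (d * c); have [s2 s2t s2H] := tH2 d.
exists (s1 \o s2); first exact: GenComp.
by rewrite scalerDr scalerA; apply: ham_approx_comp => //; apply: ord_geZ.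
Qed.

(** The bracket with such an [H] is already negligible, so the identity realises it. *)
Lemma tame_hamiltonian_high k H : ord_ge k.+2 H -> tame_hamiltonian k H.
Proof.
move=> Hk; split=> [|c]; first exact: ord_geW Hk.
exists id => [|f]; first exact: GenId.
rewrite subrr sub0r; apply/ord_geN/ord_ge_poissonl; exact: ord_geZ.
Qed.

End HamiltonianApproximation.

(** * Symplectic transvections, and extraction of coefficients *)

Section LinearForms.
Variables (K : comNzRingType) (n : nat).
Local Notation P := (mpoly (n + n) K).
Local Notation z := (@poly_gen K n).

Lemma linear_form_lin (c : K) (u v : 'I_(n + n) -> K) :
  linear_form (fun i => c * u i + v i) = c *: linear_form u + linear_form v.
Proof.
rewrite /linear_form scaler_sumr -big_split; apply: eq_bigr => i _ /=.
by rewrite scalerDl scalerA.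
Qed.

Lemma gen_linear_form j : z j = linear_form (fun i => (i == j)%:R).
Proof.
rewrite /linear_form (bigD1 j) //= eqxx scale1r big1 ?addr0 // => i /negbTE ->.
by rewrite scale0r.
Qed.

(** In the bracket of two images the terms linear in [c] cancel by antisymmetry, and the quadratic
    term contains {U, U} = 0 for U = [linear_form v]. *)
Lemma transvection_tame (c : K) (v : 'I_(n + n) -> K) :
  exists2 t, TAutP t & forall j,
    t (z j) = z j + c *: (poisson (linear_form v) (z j) * linear_form v).
Proof.
pose U := linear_form v; pose w j := mcoeff mnm0 (poisson U (z j)).
have wE j : poisson U (z j) = mpolyC _ (w j).
  by rewrite /w gen_linear_form poisson_linear_form mcoeffC eqxx mulr1.
pose M : 'M[K]_(n + n) := \matrix_(i, j) ((c * w j) * v i + (i == j)%:R).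
have ME j : linear_form (M^~ j) = z j + (c * w j) *: U.
  rewrite addrC [z j]gen_linear_form -linear_form_lin; apply: eq_bigr => i _.
  by rewrite mxE.
exists (poly_hom (fun j => linear_form (M^~ j))) => [|j]; last first.
  by rewrite poly_hom_gen ME wE mul_mpolyC scalerA.
apply: linear_tame => a b; rewrite !ME !poissonDl !poissonDr !poissonZl !poissonZr.
rewrite [poisson (z a) U]poissonC !wE poissonff !scaler0 addr0 -!mul_mpolyC !mpolyCM.
by ring.
Qed.

End LinearForms.

(* Replacing [t] by [2 t] and subtracting [2 ^+ N] times the original sum
   eliminates the top coefficient. *)
Lemma coefs_of_combinations (K : comNzRingType) (V : lmodType K) (W : V -> Prop)
    (v : nat -> V) (N : nat) :
  nats_invertible K -> W 0 -> (forall c x y, W x -> W y -> W (c *: x + y)) ->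
  (forall t : K, W (\sum_(i < N) t ^+ i *: v i)) ->
  forall i, (i < N)%N -> W (v i).
Proof.
move=> natK W0 Wlin; elim: N v => [//|N IH] v Wv i.
have WZ c x : W x -> W (c *: x) by move=> Wx; rewrite -[c *: x]addr0; apply: Wlin.
have Wlow j : (j < N)%N -> W (v j).
  move=> jN; pose e i : K := 2 ^+ i - 2 ^+ N.
  have [u ue] : exists u, u * e j = 1.
    have jN2 : (2 ^ j < 2 ^ N)%N by rewrite ltn_exp2l.
    have [u uE] := natK (2 ^ N - 2 ^ j).-1; exists (- u).
    move: uE; rewrite prednK ?subn_gt0 // natrB ?(ltnW jN2) // !natrX => <-.
    by rewrite /e; ring.
  rewrite -[v j]scale1r -ue -scalerA; apply: WZ.
  apply: (IH (fun i => e i *: v i)) jN => t.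
  have := Wlin (- 2 ^+ N) _ _ (Wv t) (Wv (2 * t)); congr W.
  rewrite !big_ord_recr /= scalerDr addrACA !scalerA exprMn -scalerDl.
  rewrite mulNr addNr scale0r addr0 scaler_sumr -big_split; apply: eq_bigr => l _ /=.
  by rewrite exprMn !scalerA -scalerDl; congr (_ *: _); rewrite /e; ring.
rewrite ltnS leq_eqVlt => /orP[/eqP ->|]; last exact: Wlow.
(* At t = 1 the top coefficient is the whole sum minus the lower ones, already known to lie in
   [W]. *)
have := Wv 1; rewrite big_ord_recr /= expr1n scale1r => WN.
rewrite -[v N](addKr (\sum_(j < N) 1 ^+ j *: v j)) -scaleN1r; apply: (Wlin) => //.
elim/big_ind: _ => // [x y Wx Wy|j _]; last exact/WZ/Wlow.
by rewrite -[x]scale1r; apply: Wlin.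
Qed.

(** * Realising all Hamiltonians of order at least k+1 by polarization *)

Section TameHamiltonians.
Variables (K : comNzRingType) (n : nat) (i0 : 'I_n) (k : nat).
Hypothesis natK : nats_invertible K.
Hypothesis k1 : (1 < k)%N.
Local Notation P := (mpoly (n + n) K).
Local Notation z := (@poly_gen K n).
Local Notation x0 := (xvar i0).
Local Notation p0 := (pvar i0).

Lemma tame_hamiltonian0 : @tame_hamiltonian K n k 0.
Proof. exact/tame_hamiltonian_high/ord_ge00. Qed.

Lemma tame_hamiltonianZ c (H : P) : tame_hamiltonian k H -> tame_hamiltonian k (c *: H).
Proof.
by move=> tH; rewrite -[c *: H]addr0; apply: tame_hamiltonian_lin => //; apply: tame_hamiltonian0.
Qed.

(** As {p_0^(k+1), x_0} = (k+1) p_0^k, adding c (k+1) p_0^k to x_0 agrees exactly with the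
    infinitesimal action on the generators. *)
Lemma elementary_approx c :
  exists2 s, TAutP s & ham_approx k (c *: z p0 ^+ k.+1) s.
Proof.
have kE : k = k.-1.+1 by rewrite prednK // ltnW.
pose h j := if j == x0 then z j + (c * k.+1%:R) *: z p0 ^+ k.-1.+1 else z j.
exists (poly_hom h); first exact: elementary_tame.
apply: ham_approx_gen => // [||j]; first exact: poly_hom_alg_hom.
  by apply: ord_geZ; rewrite -{1}[k.+1]mul1n; apply/ord_geX/ord_ge_gen.
rewrite poly_hom_gen poissonZl poissonXl /h -kE.
have -> : poisson (z p0) (z j) = (j == x0)%:R.
  rewrite -(splitK j); case: (fintype.split j) => i /=; have [px _ _ pp] := @poisson_gen K n i0 i.
    by rewrite [LHS]px eq_lshift eq_sym.
  by rewrite [LHS]pp eq_rlshift.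
case: (j == x0) => /=; last first.
  by rewrite mulr0 !scaler0 !subrr; apply: ord_ge00.
by rewrite mulr1 scalerA [z j + _]addrC addrK subrr; apply: ord_ge00.
Qed.

(** The bracket condition says that x_0 occurs in [l] with coefficient 1. *)
Definition normalized_form (l : P) :=
  (exists v, l = linear_form v) /\ poisson l (z p0) = -1.

(* The transvection along [l - p0] sends [p0] to [l]; conjugate the elementary
   transformation with Hamiltonian [p0 ^+ k.+1] by it. *)
Lemma tame_hamiltonian_power l : normalized_form l -> tame_hamiltonian k (l ^+ k.+1).
Proof.
move=> [[v lE] lp]; split=> [|c].
  by rewrite -{1}[k.+1]mul1n; apply: ord_geX; rewrite lE; apply: ord_ge_linear_form.
have [t tT tE] := transvection_tame (-1) (fun i => -1 * (i == p0)%:R + v i).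
have tp : t (z p0) = l.
  rewrite tE linear_form_lin -gen_linear_form -lE !scaleN1r poissonDl poissonNl poissonff.
  by rewrite lp oppr0 add0r mulN1r opprK addrA subrr add0r.
have [s sT sH] := elementary_approx c.
have tS := TAutP_origin_symplecto tT.
have [[[th [t' tt' t't]] _] _] := tS.
exists (t \o s \o t'); first exact: GenComp (GenComp tT sT) (GenInv tT tt' t't).
rewrite (_ : c *: l ^+ k.+1 = t (c *: z p0 ^+ k.+1)); first exact: ham_approx_conj.
by rewrite (alg_homZ _ th) (alg_homX _ _ th) tp.
Qed.

(** Induction on [d], splitting a generator z_j off [m]. Since j is not x_0, every l + t z_j is
    still normalized, so the induction hypothesis covers (l + t z_j)^(N+1) x^m' for all t. Its
    coefficient of t is (N+1) l^N z_j x^m'. *)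
Lemma polarization d (m : multinom (n + n)) l : m x0 = 0%N -> mdeg m = d ->
  (d <= k.+1)%N -> normalized_form l ->
  tame_hamiltonian k (l ^+ (k.+1 - d) * mpolyX K m).
Proof.
elim: d m l => [|d IH] m l mx0 md dk ln.
  move/eqP: md; rewrite mdeg_eq0 => /eqP ->; rewrite mpolyX0 mulr1 subn0.
  exact: tame_hamiltonian_power.
have [j mj] : exists j, m j != 0%N.
  apply/existsP; apply: contraT; rewrite negb_exists => /forallP m0.
  by move: md; rewrite mdegE big1 // => i _; apply/eqP; rewrite -[_ == _]negbK.
have jx0 : j != x0 by apply: contraNneq mj => ->; rewrite mx0.
pose m' := mnm_sub m (mnm1 j).
have mE : m = mnm_add m' (mnm1 j).
  apply/mnmP => i; rewrite mnmDE mnmBE mnm1E; case: eqP => [<-|_].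
    by rewrite subnK // lt0n.
  by rewrite subn0 addn0.
have m'd : mdeg m' = d by apply/eqP; rewrite -eqSS -md {1}mE mdegD mdeg1 addn1.
have m'x0 : m' x0 = 0%N by rewrite mnmBE mx0.
set N := (k.+1 - d.+1)%N.
have NE : (k.+1 - d = N.+1)%N by rewrite /N -subSn.
(* The coefficient of t^i in (l + t z_j)^(N+1) x^m'. *)
pose c i : P := ((l ^+ (N.+1 - i) * z j ^+ i) *+ 'C(N.+1, i)) * mpolyX K m'.
have : tame_hamiltonian k (c 1%N).
  apply: (@coefs_of_combinations _ _ _ c N.+2) => // [||t].
  - exact: tame_hamiltonian0.
  - by move=> ? ? ?; apply: tame_hamiltonian_lin.
  have ln' : normalized_form (l + t *: z j).
    have [[v lE] lp] := ln; split.
      exists (fun i => t * (i == j)%:R + v i).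
      by rewrite linear_form_lin -gen_linear_form -lE addrC.
    rewrite poissonDl lp poissonZl [X in _ *: X](_ : _ = 0) ?scaler0 ?addr0 //.
    move: jx0; rewrite -(splitK j); case: (fintype.split j) => i /=;
      have [_ xp _ pp] := @poisson_gen K n i i0; last by rewrite [LHS]pp.
    by rewrite [_ == _]eq_lshift [LHS]xp => /negbTE ->; rewrite oppr0.
  have := IH _ _ m'x0 m'd (ltnW dk) ln'; congr (tame_hamiltonian k _).
  rewrite NE exprDn mulr_suml; apply: eq_bigr => i _.
  by rewrite /c scalerAl exprZn -scalerAr scalerMnr.
have [u uN] := natK N.
move/(tame_hamiltonianZ u); congr (tame_hamiltonian k _).
rewrite /c bin1 subn1 expr1 -scaler_nat -scalerAl scalerA uN scale1r mE mpolyXD.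
by rewrite -mulrA [z j * _]mulrC.
Qed.

Lemma tame_hamiltonian_ord_ge (H : P) : ord_ge k.+1 H -> tame_hamiltonian k H.
Proof.
move=> Hk; rewrite [H]mpolyE; elim/big_ind: _ => [|f g tf tg|m _].
- exact: tame_hamiltonian0.
- by rewrite -[f]scale1r; apply: tame_hamiltonian_lin.
have [mk|km|mk] := ltngtP (mdeg m) k.+1.
- by rewrite Hk // scale0r; apply: tame_hamiltonian0.
- apply/tame_hamiltonian_high/ord_geZ; apply: ord_geW km _; exact: ord_ge_monom.
apply: tame_hamiltonianZ.
(* Write the monomial as a power of x_0 times a monomial free of x_0, and polarize with l = x_0. *)
pose e := mnm_muln (mnm1 x0) (m x0); pose m' := mnm_sub m e.
have eE i : e i = if i == x0 then m i else 0%N.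
  by rewrite mulmnE mnm1E eq_sym; case: eqP => [->|_]; rewrite ?mul1n ?mul0n.
have mE : m = mnm_add e m'.
  by apply/mnmP => i; rewrite mnmDE mnmBE eE subnKC //; case: ifP.
have dE : (mdeg m = m x0 + mdeg m')%N by rewrite {1}mE mdegD mdegMn mdeg1 mul1n.
rewrite mE mpolyXD -mpolyXn -/(z x0) (_ : m x0 = k.+1 - mdeg m')%N; last first.
  by rewrite -mk dE addnK.
apply: polarization => //; first by rewrite mnmBE eE eqxx subnn.
  by rewrite -mk dE leq_addl.
split; first by exists (fun i => (i == x0)%:R); apply: gen_linear_form.
by have [_ -> _ _] := @poisson_gen K n i0 i0; rewrite eqxx.
Qed.

End TameHamiltonians.

(** * Tame approximation, one degree at a time *)

Section TameApproximation.
Variables (K : comNzRingType) (n : nat).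
Hypothesis natK : nats_invertible K.
Local Notation P := (mpoly (n + n) K).
Local Notation z := (@poly_gen K n).
Implicit Types (s t : P -> P).

(** The differential of [s] at the origin is symplectic: terms of order 2 do not affect the constant
    terms of brackets, and brackets of linear forms are constants. *)
Lemma tame_linear_part s : origin_symplecto s ->
  exists2 t, TAutP t & forall j, ord_ge 2 (s (z j) - t (z j)).
Proof.
move=> [[[sh _] sP] s0].
pose M : 'M[K]_(n + n) := \matrix_(i, j) mcoeff (mnm1 i) (s (z j)).
pose L j := linear_form (M^~ j).
have r2 j : ord_ge 2 (s (z j) - L j).
  move=> m; rewrite ltnS leq_eqVlt ltnS leqn0 mdeg_eq0 mcoeffB orbC.
  case/orP => [/eqP->|/mdeg1P[i /eqP ->]].
    by rewrite s0 ord_ge_linear_form ?mdeg0 // subr0.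
  rewrite /L /linear_form raddf_sum /= (bigD1 i) //= big1 => [|l li].
    by rewrite mcoeffZ mcoeffX eqxx mulr1 mxE addr0 subrr.
  rewrite mcoeffZ mcoeffX; case: eqP => [/(congr1 (fun m : multinom _ => m l))|_].
    by rewrite !mnm1E eqxx eq_sym (negbTE li).
  by rewrite mulr0.
exists (poly_hom L) => [|j]; last by rewrite poly_hom_gen.
apply: linear_tame => a b; rewrite poisson_gen_form.
have : mcoeff mnm0 (poisson (s (z a)) (s (z b)) - poisson (L a) (L b)) = 0.
  apply/ord_ge1_mcoeff0.
  have -> : poisson (s (z a)) (s (z b)) - poisson (L a) (L b) =
      poisson (s (z a) - L a) (s (z b)) - poisson (s (z b) - L b) (L a).
    by rewrite !poissonDl !poissonNl [poisson (s (z b)) _]poissonC [poisson (L b) _]poissonC; ring.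
  by apply: ord_geB; apply: ord_ge_poissonl.
rewrite -sP poisson_gen_form poisson_linear_form -alg_mpolyC alg_homZ // sh.2.1 alg_mpolyC.
by rewrite -mpolyCB mcoeffC eqxx mulr1 => /eqP; rewrite subr_eq0 => /eqP ->.
Qed.

Lemma tame_correction k s : (0 < n)%N -> (1 < k)%N -> origin_symplecto s ->
  (forall j, ord_ge k (s (z j) - z j)) ->
  exists2 t, TAutP t & forall j, ord_ge k.+1 (s (z j) - t (z j)).
Proof.
move=> n0 k1 [[[sh _] sP] s0] sk; pose D a : P := s (z a) - z a.
have [|a b|H Hk HD] := @hamiltonian_mod K n k D natK; first exact: sk.
  (* Expand {z_a + D_a, z_b + D_b} = {z_a, z_b}, a constant fixed by [s]. The quadratic term has
     order at least 2(k-1), hence at least k because k >= 2. *)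
  have -> : poisson (D a) (z b) + poisson (z a) (D b) = - poisson (D a) (D b).
    rewrite /D !poissonDl !poissonDr !poissonNl !poissonNr -sP.
    rewrite poisson_gen_form -alg_mpolyC (alg_homZ _ sh) sh.2.1; ring.
  apply: ord_geN; case: k k1 sk => [|[|k]] // _ sk.
  apply: ord_geW (ord_ge_poisson (sk a) (sk b)).
  by rewrite addSn addnS !ltnS leq_addr.
have [_ /(_ 1) [t tT tH]] := tame_hamiltonian_ord_ge (Ordinal n0) natK k1 Hk.
exists t => // j.
have -> : s (z j) - t (z j) =
    - (t (z j) - z j - poisson H (z j)) - (poisson H (z j) - D j).
  by rewrite /D; ring.
by apply: ord_geB => //; apply: ord_geN; rewrite -[H]scale1r; apply: tH.
Qed.

Lemma tame_approximation s k : (0 < n)%N -> origin_symplecto s ->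
  exists2 t, TAutP t & forall j, ord_ge k (s (z j) - t (z j)).
Proof.
(* The shift to [k.+2] lets the induction start at the linear part and keeps every correction in the
   range k >= 2. *)
move=> n0 sS; have [t tT st] : exists2 t, TAutP t & forall j, ord_ge k.+2 (s (z j) - t (z j)).
  elim: k => [|k [t tT st]]; first exact: tame_linear_part.
  have tS := TAutP_origin_symplecto tT.
  have [[[th [t' tt' t't]] _] t0] := tS.
  have t'S := origin_symplecto_inv tS tt' t't.
  have [[[t'h _] _] t'0] := t'S.
  have [j|u uT tu] := @tame_correction k.+2 _ n0 isT (origin_symplecto_comp t'S sS).
    by rewrite /= -{2}[z j]tt' -alg_homB //; apply: ord_ge_alg_hom.
  exists (t \o u) => [|j]; first exact: GenComp.
  by rewrite /= -{1}[s (z j)]t't -alg_homB //; exact: ord_ge_alg_hom (tu j).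
by exists t => // j; apply: ord_geW (st j); rewrite -addn2 leq_addr.
Qed.

End TameApproximation.

(** * From orders of vanishing to the power series metric *)

Section FormalPowerSeriesDistance.
Variables (R : realType) (K : comNzRingType) (n : nat).
Local Notation P := (mpoly (n + n) K).
Local Notation z := (@poly_gen K n).

Lemma height_ord_ge k (f : P) : ord_ge k f -> (k%:R%:E <= height R f)%E.
Proof.
move=> fk; apply: le_ereal_inf_tmp => _ [d /= fd <-]; rewrite lee_fin ler_nat leqNgt.
apply: contra fd => dk; apply/eqP; rewrite /pihomog big_seq_cond big1 // => m.
by case/andP=> _ /eqP md; rewrite fk ?scale0r // md.
Qed.

Lemma fps_dist_ord_ge k (s t : P -> P) : (forall j, ord_ge k (s (z j) - t (z j))) ->
  0 <= fps_dist R s t <= expR (- k%:R).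
Proof.
move=> st; rewrite /fps_dist; set h := tuple_height _ _.
have hk : (k%:R%:E <= h)%E.
  rewrite /h /tuple_height; elim/big_ind: _ => [|x y kx ky|j _].
  - exact: leey.
  - by rewrite le_min kx ky.
  - exact: height_ord_ge.
have : (0 <= expeR (- h) <= (expR (- k%:R))%:E)%E.
  by rewrite expeR_ge0 /= -[leRHS]/(expeR (- k%:R)%:E) lee_expeR EFinN leeN2.
(* The finite bounds exclude infinite values, so [fine] does not alter the exponential. *)
by case: (expeR (- h)) => [x| |] //=; rewrite leye_eq andbF.
Qed.

End FormalPowerSeriesDistance.

(** * Lifting the approximations to the Weyl algebra, and convergence *)

Theorem theorem3 (R : realType) (n : nat) (hn : (1 <= n)%N)
    (Phi : (weyl R[i] n -> weyl R[i] n) -> (mpoly (n + n) R[i] -> mpoly (n + n) R[i]))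
    (hPhi : canonical_iso Phi)
    (sigma : mpoly (n + n) R[i] -> mpoly (n + n) R[i])
    (hsigma : symplectomorphism sigma) (horigin : origin_preserving sigma) :
  exists psi : nat -> (weyl R[i] n -> weyl R[i] n),
    (forall k, TAutW (psi k)) /\
    (fun k => fps_dist R (Phi (psi k)) sigma) @ \oo --> (0 : R).
Proof.
have natK : nats_invertible R[i].
  by move=> m; exists m.+1%:R^-1; rewrite mulVf // pnatr_eq0.
have [[_ _ Phi_surj] _ _] := hPhi.
(* Surjectivity of [Phi] lifts the tame approximation of order [k] to the Weyl algebra. *)
have approx k : exists2 f, TAutW f &
    forall j, ord_ge k (Phi f (poly_gen R[i] j) - sigma (poly_gen R[i] j)).
  have [t tT st] := tame_approximation natK k hn (conj hsigma horigin).
  have [f fT ft] := Phi_surj t tT; exists f => // j.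
  by rewrite ft -opprB; apply/ord_geN/st.
have [psi psiP] := choice (fun k => let: ex_intro2 f fT fk := approx k in
  ex_intro (fun f => TAutW f /\ _) f (conj fT fk)).
exists psi; split=> [k|]; first by have [] := psiP k.
(* Agreement up to order k bounds the k-th distance by exp(-k). *)
apply: (@squeeze_cvgr _ _ _ _ (fun=> 0) (fun k : nat => expR (- k%:R))).
- by near=> k; apply: fps_dist_ord_ge; have [] := psiP k.
- exact: cvg_cst.
apply: (@cvg_comp _ _ _ (fun k : nat => k%:R : R) (fun x => expR (- x)) _ (pinfty_nbhs R)).
  exact: cvgr_idn.
exact: cvgr_expR.
Unshelve. all: by end_near.
Qed.
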